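(* Let $\partial$ be a generator on $\mathbf N$ with hull operator $\mu\mapsto[\mu]$, and let $\eta$ be a Poisson process on $\mathbb X$ with locally finite intensity measure $\lambda$. For each $n\in\mathbb N=\{1,2,\dots\}$, one has the equality of measures on $\mathbf N\times\mathbf N$ $$\mathbb E\Big[\mathbf 1\{\partial\eta(\mathbb X)=n\}\,\mathbf 1\{(\partial\eta,\eta_{[\eta]})\in\cdot\}\Big]=\frac1{n!}\,\mathbb E\int_{C_n}\mathbf 1\{(\delta_{\mathbf x},\eta_{[\mathbf x]})\in\cdot\}\,\exp\big[-\lambda([\mathbf x]^c)\big]\,\lambda^n(d\mathbf x).$$ Moreover, if $\partial\eta$ is almost surely finite (that is, $\partial\eta(\mathbb X)<\infty$ a.s.), then $$\mathbb P\big(\eta_{[\eta]}\in\cdot\mid\partial\eta\big)=\Pi_{\lambda_{[\eta]}}(\cdot),\qquad \mathbb P\text{-a.s.}$$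
   Context: $(\mathbb X,\mathcal X)$ is a Borel space with a localising ring $\mathcal X_0\subset\mathcal X$: a ring of sets such that (a) $B\in\mathcal X_0$, $C\in\mathcal X$ imply $B\cap C\in\mathcal X_0$; (b) there is an increasing sequence $B_n\in\mathcal X_0$, $n\in\mathbb N$, with union $\mathbb X$ such that each set in $\mathcal X_0$ has the form $C\cap B_n$ for some $C\in\mathcal X$, $n\in\mathbb N$. A measure is locally finite if it is finite on $\mathcal X_0$. $\mathbf N$ is the set of all measures $\mu$ on $\mathbb X$ with $\mu(B)\in\{0,1,2,\dots\}$ for all $B\in\mathcal X_0$, equipped with the smallest $\sigma$-field making $\mu\mapsto\mu(B)$ measurable for all $B\in\mathcal X$. Write $\operatorname{supp}\mu=\{x:\mu(\{x\})>0\}$; $x\in\mu$ means $x\in\operatorname{supp}\mu$; $\delta_x$ is the Dirac measure at $x$; $\nu_B:=\nu(\cdot\cap B)$; $\nu'\le\nu$ means $\nu'(B)\le\nu(B)$ for all $B\in\mathcal X$. A generator is a measurable map $\partial:\mathbf N\to\mathbf N$ such that: (thinning) $\partial\mu\le\mu$ for all $\mu$; (additivity) $\partial(\mu+\delta_x)=\partial\mu+\delta_x$ for all $\mu\in\mathbf N$, $x\in\partial\mu$; (idempotency) $\partial(\partial\mu+\mu')=\partial\mu$ for all $\mu,\mu'\in\mathbf N$ with $\mu'\le\mu-\partial\mu$; (consistency) if $\mu'\le\mu$ and $\partial\mu=\partial\mu'$, then $\partial(\mu+\psi)=\partial(\mu'+\psi)$ for all $\psi\in\mathbf N$. The hull operator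 is $[\mu]:=\{x\in\mathbb X:\partial(\mu+\delta_x)=\partial\mu\}$. A Poisson process with intensity measure $\lambda$ is a random element $\eta$ of $\mathbf N$ (on a probability space $(\Omega,\mathcal F,\mathbb P)$) with independent Poisson distributed increments and $\mathbb E\eta(B)=\lambda(B)$; its distribution is denoted $\Pi_\lambda$. For $\mathbf x=(x_1,\dots,x_n)\in\mathbb X^n$ put $\delta_{\mathbf x}:=\delta_{x_1}+\dots+\delta_{x_n}$ and $[\mathbf x]:=[\delta_{\mathbf x}]$. $C_n$ is the set of all $\mathbf x\in\mathbb X^n$ with $\partial\delta_{\mathbf x}=\delta_{\mathbf x}$. *)

(* Defs.v *)
From HB Require Import structures.
From mathcomp Require Import all_boot all_order all_algebra.
From mathcomp Require Import all_classical all_reals all_analysis.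
From mathcomp Require Import measurable_realfun giry.

Set Implicit Arguments.
Unset Strict Implicit.
Unset Printing Implicit Defensive.

Import Order.TTheory GRing.Theory Num.Theory.
Import numFieldNormedType.Exports.

Local Open Scope classical_set_scope.
Local Open Scope ring_scope.
Local Open Scope ereal_scope.

(* X is isomorphic, as a measurable space, to a Borel subset D of the unit
   interval. *)
Definition borel_space (R : realType) (d : measure_display)
    (X : measurableType d) : Prop :=
  exists (D : set R) (f : X -> R) (g : R -> X),
    [/\ measurable D /\ D `<=` `[0%R, 1%R],
        measurable_fun [set: X] f /\ (forall x, D (f x)),
        measurable_fun D g,
        cancel f g
      & forall r, D r -> f (g r) = r].

Record localising_ring (d : measure_display) (X : measurableType d)
    (X0 : set (set X)) : Prop := {
  lring_measurable : X0 `<=` measurable ;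
  lring_setring : setring X0 ;
  lring_setI : forall B C, X0 B -> measurable C -> X0 (B `&` C) ;
  lring_exhaustion : exists Bn : (set X)^nat,
    [/\ nondecreasing_seq Bn, forall n, X0 (Bn n), \bigcup_n Bn n = setT
      & forall B, X0 B -> exists C n, measurable C /\ B = C `&` Bn n] }.

Definition locally_finite (R : realType) (d : measure_display)
    (X : measurableType d) (X0 : set (set X)) (mu : set X -> \bar R) : Prop :=
  forall B, X0 B -> mu B < +oo.

(* The space N. The values of a MathComp-Analysis measure on non-measurable
   sets are arbitrary, so equality of elements of N is always expressed by
   measure_eq (equality on measurable sets). *)
Record point_measure (R : realType) (d : measure_display)
    (X : measurableType d) (X0 : set (set X)) := PointMeasure {
  pm_val :> {measure set X -> \bar R} ;
  pm_nat : forall B, X0 B -> exists k : nat, pm_val B = k%:R%:E }.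

Section point_measure_space.
Context (R : realType) (d : measure_display) (X : measurableType d).
Variable X0 : set (set X).

Let N := point_measure R X0.

Let mzero_nat (B : set X) : X0 B -> exists k : nat, mzero B = k%:R%:E :> \bar R.
Proof. by exists 0%N. Qed.

Definition pm_zero : N := @PointMeasure R d X X0 mzero mzero_nat.

Let dirac_nat (x : X) (B : set X) :
  X0 B -> exists k : nat, \d_x B = k%:R%:E :> \bar R.
Proof. by move=> _; rewrite diracE; exists (x \in B). Qed.

Definition pm_dirac (x : X) : N := PointMeasure (@dirac_nat x).

Let add_nat (mu nu : N) (B : set X) :
  X0 B -> exists k : nat, measure_add mu nu B = k%:R%:E.
Proof.
move=> XB; have [k kE] := pm_nat mu XB; have [l lE] := pm_nat nu XB.
by exists (k + l)%N; rewrite measure_addE kE lE natrD EFinD.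
Qed.

Definition pm_add (mu nu : N) : N := PointMeasure (@add_nat mu nu).

Definition pm_tuple (n : nat) (x : n.-tuple X) : N :=
  \big[pm_add/pm_zero]_(i < n) pm_dirac (tnth x i).

HB.instance Definition _ := gen_eqMixin (point_measure R X0).
HB.instance Definition _ := gen_choiceMixin (point_measure R X0).
HB.instance Definition _ := isPointed.Build (point_measure R X0) pm_zero.

Definition pm_ev (B : set X) (mu : N) : \bar R := mu B.

Definition pm_measurable : set (set N) :=
  <<s \bigcup_(B in measurable)
        preimage_set_system [set: N] (pm_ev B) measurable >>.

Let pm_measurable0 : pm_measurable set0.
Proof. exact: sigma_algebra0. Qed.

Let pm_measurableC (U : set N) : pm_measurable U -> pm_measurable (~` U).
Proof. exact: sigma_algebraC. Qed.

Let pm_measurableU (F : (set N)^nat) :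
  (forall i, pm_measurable (F i)) -> pm_measurable (\bigcup_i F i).
Proof. exact: sigma_algebra_bigcup. Qed.

Definition pm_display : measure_display.
Proof. by constructor. Qed.

HB.instance Definition _ := @isMeasurable.Build pm_display
  (point_measure R X0) pm_measurable pm_measurable0 pm_measurableC
  pm_measurableU.

End point_measure_space.

Arguments pm_zero {R d X}.
Arguments pm_dirac R {d X}.
Arguments pm_tuple R {d X} X0 {n}.

Definition measure_le (R : realType) (d : measure_display)
    (X : measurableType d) (mu nu : set X -> \bar R) : Prop :=
  forall B, measurable B -> mu B <= nu B.

Definition restriction (R : realType) (d : measure_display)
    (X : measurableType d) (nu : set X -> \bar R) (D : set X) :
    set X -> \bar R :=
  fun B => nu (B `&` D).

Section pm_restriction.
Context (R : realType) (d : measure_display) (X : measurableType d).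
Variable X0 : set (set X).
Hypothesis X0ring : localising_ring X0.
Variable mu : point_measure R X0.

Let mrestr_nat (D : set X) (mD : measurable D) (B : set X) :
  X0 B -> exists k : nat, mrestr mu mD B = k%:R%:E.
Proof.
by move=> XB; apply: pm_nat; exact: lring_setI X0ring _ _ XB mD.
Qed.

(* The restriction of mu to D as an element of N. The library's mrestr is a
   measure only if D is measurable; for other D the value is irrelevant. Below,
   D is a hull, which is measurable when X is a Borel space. *)
Definition pm_restr (D : set X) : point_measure R X0 :=
  if pselect (measurable D) is left mD then PointMeasure (@mrestr_nat D mD)
  else pm_zero X0.

End pm_restriction.

Section generator.
Context (R : realType) (d : measure_display) (X : measurableType d).
Variable X0 : set (set X).

Let N := point_measure R X0.

(* In gen_idempotent, nu is the measure mu - del mu. *)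
Record generator (del : N -> N) : Prop := {
  gen_measurable : measurable_fun [set: N] del ;
  gen_thinning : forall mu, measure_le (del mu) mu ;
  gen_additive : forall (mu : N) (x : X), 0 < del mu [set x] ->
    del (pm_add mu (pm_dirac R X0 x)) ≡μ pm_add (del mu) (pm_dirac R X0 x) ;
  gen_idempotent : forall mu mu' nu : N,
    pm_add (del mu) nu ≡μ mu -> measure_le mu' nu ->
    del (pm_add (del mu) mu') ≡μ del mu ;
  gen_consistent : forall mu mu' : N,
    measure_le mu' mu -> del mu ≡μ del mu' ->
    forall psi, del (pm_add mu psi) ≡μ del (pm_add mu' psi) }.

Definition hull (del : N -> N) (mu : N) : set X :=
  [set x | del (pm_add mu (pm_dirac R X0 x)) ≡μ del mu].

Definition C_ (del : N -> N) (n : nat) : set (n.-tuple X) :=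
  [set x | del (pm_tuple R X0 x) ≡μ pm_tuple R X0 x].

End generator.

Arguments C_ {R d X X0} del n.

Section probability.
Context (R : realType) (dO : measure_display) (Omega : measurableType dO).
Variable P : probability Omega R.

(* rate +oo is the point mass at +oo; the formula is used at finite rates
   because poisson_pmf is identically 1 at rate 0. *)
Definition poisson_distributed (Y : Omega -> \bar R) (rate : \bar R) : Prop :=
  match rate with
  | r%:E => (0 <= r)%R /\ forall k : nat,
      P [set w | Y w = k%:R%:E] = (expR (- r) * r ^+ k / k`!%:R)%:E
  | +oo => P [set w | Y w = +oo] = 1
  | -oo => False
  end.

(* Taking A i = setT for some of the i gives the product rule for every
   subfamily. *)
Definition independent (m : nat) (Y : 'I_m -> Omega -> \bar R) : Prop :=
  forall A : 'I_m -> set (\bar R), (forall i, measurable (A i)) ->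
    P (\bigcap_i (Y i @^-1` A i)) = \prod_(i < m) P (Y i @^-1` A i).

Record poisson_process (d : measure_display) (X : measurableType d)
    (X0 : set (set X)) (eta : Omega -> point_measure R X0)
    (lam : set X -> \bar R) : Prop := {
  pp_measurable : measurable_fun [set: Omega] eta ;
  pp_poisson : forall B, measurable B ->
    poisson_distributed (fun w => eta w B) (lam B) ;
  pp_intensity : forall B, measurable B -> \int[P]_w eta w B = lam B ;
  pp_independent : forall (m : nat) (B : 'I_m -> set X),
    (forall i, measurable (B i)) -> trivIset [set: 'I_m] B ->
    independent (fun i w => eta w (B i)) }.

(* f is a version of the conditional probability P(E | Z). *)
Record cond_prob (d : measure_display) (T : measurableType d)
    (Z : Omega -> T) (E : set Omega) (f : Omega -> \bar R) : Prop := {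
  cond_prob_measurable :
    measurable_fun [set: g_sigma_algebra_preimageType Z] f ;
  cond_prob_integral : forall B : set T, measurable B ->
    \int[P]_(w in Z @^-1` B) f w = P (E `&` Z @^-1` B) }.

End probability.

(* The distribution Pi_lam: the law Q on N under which the identity map is a
   Poisson process with intensity lam (determined on measurable sets; an
   arbitrary law if there is none). *)
Definition poisson_law (R : realType) (d : measure_display)
    (X : measurableType d) (X0 : set (set X)) (lam : set X -> \bar R) :
    probability (point_measure R X0) R :=
  xget point [set Q | poisson_process Q (@id (point_measure R X0)) lam].

(* The product measure lam^n, identifying (t, x) with the tuple x :: t. *)
Fixpoint power_measure (R : realType) (d : measure_display)
    (X : measurableType d) (lam : set X -> \bar R) (n : nat) :
    set (n.-tuple X) -> \bar R :=
  match n with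
  | 0%N => \d_[tuple]
  | m.+1 => pushforward (@power_measure R d X lam m \x lam)
              (fun p : m.-tuple X * X => [tuple of p.2 :: p.1])
  end.

Arguments power_measure {R d X} lam n.

(* Main.v *)
(* Write [x] for the hull of the tuple x and eta_D for the restriction of eta
   to D. The axioms of a generator give del mu = mu_{[mu]^c} and show that
   del (delta_x + mu) = delta_x holds iff x is in C_n and mu([x]^c) = 0, whether
   or not mu is finite. On {del eta (X) = n}, the restriction of eta to [eta]^c
   has n points, so integrating one of them out by Mecke's equation n times
   rewrites n! E[1{del eta (X) = n} F(del eta, eta_{[eta]})] as the integral
   against lam^n of E[1{del (delta_x + eta) = delta_x} F(delta_x, eta_{[x]})];
   the remaining indicator forces eta([x]^c) = 0, which is independent of
   eta_{[x]} and has probability exp(-lam([x]^c)). The argument works for n = 0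
   as well, and the conditional law follows by summing over n >= 0, since both
   F(phi, psi) = 1_B(phi) Pi_{lam_{[phi]}}(A) and F(phi, psi) = 1_B(phi) 1_A(psi)
   give the same right-hand side. *)
Require Import Defs.
From HB Require Import structures.
From mathcomp Require Import all_boot all_order all_algebra.
From mathcomp Require Import all_classical all_reals all_analysis.
From mathcomp Require Import measurable_realfun giry ring.

Set Implicit Arguments.
Unset Strict Implicit.
Unset Printing Implicit Defensive.

Import Order.TTheory GRing.Theory Num.Theory.
Import numFieldNormedType.Exports.

Local Open Scope classical_set_scope.
Local Open Scope ring_scope.
Local Open Scope ereal_scope.

(** The axioms speak of measures, but that the selection is [mu] off its hull has to be checked
    point by point. The bridge is that integer values on the ring force a measure charging a set to
    charge a point of it, which is where the order of the line enters through the Borel isomorphism.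
    At a point, additivity forbids selected points in the hull, and idempotency followed by
    consistency puts every discarded point into it. The Borel isomorphism serves a second time:
    countably many evaluations separate N, so [≡μ] is a measurable relation and hulls depend
    measurably on the configuration. Mecke's equation itself comes from the recursion (k+1) p(k+1) =
    r p(k) of the Poisson weights, through cells with prescribed counts. Its iteration has to
    remember that the points drawn earlier are still selected when another one is drawn; once k are
    drawn, n - k selected points remain, and the product of these factors is the n! of the
    formula. *)

Lemma measurableT_preimage d d' (T : measurableType d) (U : measurableType d')
    (f : T -> U) (A : set U) :
  measurable_fun [set: T] f -> measurable A -> measurable (f @^-1` A).
Proof. by move=> mf mA; rewrite -[X in measurable X]setTI; exact: mf. Qed.

(** * Point measures *)

Section point_measures.
Context (R : realType) (d : measure_display) (X : measurableType d).
Context (X0 : set (set X)).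
Notation N := (point_measure R X0).
Implicit Types (mu nu : N) (B : set X).

Lemma measurable_pm_ev B : measurable B ->
  measurable_fun [set: N] (fun mu => mu B).
Proof.
move=> mB _ A mA; apply: sub_sigma_algebra.
by exists B => //; exists A.
Qed.

Lemma pm_addE mu nu B : pm_add mu nu B = mu B + nu B.
Proof. exact: measure_addE. Qed.

Lemma measurable_pmP d' (T : measurableType d') (f : T -> N) :
  (forall B, measurable B -> measurable_fun [set: T] (fun t => f t B)) ->
  measurable_fun [set: T] f.
Proof.
move=> mf.
pose G : set_system N := \bigcup_(B in measurable)
  preimage_set_system [set: N] (@pm_ev R d X X0 B) measurable.
apply: (measurability G) => // _ [_ [C mC [Z mZ <-]] <-].
by rewrite !setTI; have := mf C mC measurableT Z mZ; rewrite setTI.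
Qed.

Lemma measurable_pm_add d' (T : measurableType d') (f g : T -> N) :
  measurable_fun [set: T] f -> measurable_fun [set: T] g ->
  measurable_fun [set: T] (fun t => pm_add (f t) (g t)).
Proof.
move=> mf mg; apply: measurable_pmP => B mB.
under eq_fun do rewrite pm_addE.
apply: emeasurable_funD.
  exact: (measurableT_comp (measurable_pm_ev mB) mf).
exact: (measurableT_comp (measurable_pm_ev mB) mg).
Qed.

Lemma measurable_pm_dirac : measurable_fun [set: X] (pm_dirac R X0).
Proof.
apply: measurable_pmP => B mB; apply/measurable_EFinP.
exact: measurable_indic.
Qed.

Lemma measurable_add_dirac : measurable_fun [set: N * X]
  (fun p => pm_add p.1 (pm_dirac R X0 p.2)).
Proof.
apply: measurable_pm_add => //.
exact: (measurableT_comp measurable_pm_dirac measurable_snd).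
Qed.

(** The sets that do not separate [mu] from [nu] form a sigma-algebra containing the preimages under
    evaluations. Hence measurable maps on N never see the arbitrary values that measures take off
    the measurable sets. *)
Lemma measurable_pm_saturated (A : set N) mu nu :
  measurable A -> mu ≡μ nu -> A mu -> A nu.
Proof.
move=> mA munu; suff : A mu <-> A nu by case.
have sA : sigma_algebra [set: N] [set U | U mu <-> U nu].
  split => [//|U /= [h1 h2]|U /= h]; first by split=> -[_ h]; split; tauto.
  by split=> -[n _ Un]; exists n => //; apply/(h n).
apply: (smallest_sub sA _ mA) => _ [B mB [Z mZ <-]] /=.
by rewrite /= /pm_ev munu.
Qed.

Lemma measurable_ereal_pm_eq (f : N -> \bar R) mu nu :
  measurable_fun [set: N] f -> mu ≡μ nu -> f mu = f nu.
Proof.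
move=> mf munu; apply/esym.
apply: (@measurable_pm_saturated (f @^-1` [set f mu]) mu nu) => //.
exact: (measurableT_preimage mf (emeasurable_set1 _)).
Qed.

Lemma measurable_fun_pm_eq (f : N -> N) mu nu :
  measurable_fun [set: N] f -> mu ≡μ nu -> f mu ≡μ f nu.
Proof.
move=> mf munu S mS.
exact: (measurable_ereal_pm_eq (measurableT_comp (measurable_pm_ev mS) mf) munu).
Qed.
End point_measures.

Definition push (R : realType) (d d' : measure_display) (T : measurableType d)
    (U : measurableType d') (m : {measure set T -> \bar R}) (f : T -> U)
    (mf : measurable_fun [set: T] f) : {measure set U -> \bar R} :=
  measure_function_pushforward__canonical__measure_function_Measure m mf.

(** * Localising rings and integrality *)

Section localising.
Context (R : realType) (d : measure_display) (X : measurableType d).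
Context (X0 : set (set X)) (hX0 : localising_ring X0).
Notation N := (point_measure R X0).
Implicit Types (mu nu : N) (B : set X).

Lemma lring0 : X0 set0.
Proof. by case: (lring_setring hX0). Qed.

Lemma lring_cover : exists Bn : (set X)^nat,
  [/\ nondecreasing_seq Bn, forall n, X0 (Bn n), forall n, measurable (Bn n)
    & \bigcup_n Bn n = setT].
Proof.
have [Bn [nd X0B UB _]] := lring_exhaustion hX0.
by exists Bn; split => // n; exact/(lring_measurable hX0).
Qed.

Lemma lring_set1 x : measurable [set x] -> X0 [set x].
Proof.
move=> m1; have [Bn [_ X0B _ UB]] := lring_cover.
have [n _ Bnx] : (\bigcup_n Bn n) x by rewrite UB.
rewrite (_ : [set x] = Bn n `&` [set x]); first exact: (lring_setI hX0).
by rewrite setIC; apply/esym/setIidl => _ ->.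
Qed.

Lemma pm_lty mu B : X0 B -> mu B < +oo.
Proof. by move=> /(pm_nat mu)[k ->]; rewrite ltry. Qed.

Lemma measure_cvg_exhaustion (m : {measure set X -> \bar R}) (Bn : (set X)^nat) B :
  nondecreasing_seq Bn -> (forall n, measurable (Bn n)) ->
  \bigcup_n Bn n = setT -> measurable B ->
  m (B `&` Bn n) @[n --> \oo] --> m B.
Proof.
move=> nd mBn UB mB.
rewrite -[X in _ --> m X](setIT B) -UB setI_bigcupr.
apply: nondecreasing_cvg_mu.
- by move=> n; exact: measurableI.
- by apply: bigcupT_measurable => n; exact: measurableI.
- by move=> i j /nd /subsetPset ij; apply/subsetPset; exact: setIS.
Qed.

(** Integrality is assumed on the ring only. Along an exhaustion the masses are integers increasing
    to the finite value [mu B], so they reach a largest one and stay there. *)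
Lemma pm_natT mu B : measurable B -> mu B < +oo -> exists k : nat, mu B = k%:R%:E.
Proof.
move=> mB muB; have [Bn [nd X0B mBn UB]] := lring_cover.
have cv := @measure_cvg_exhaustion mu _ _ nd mBn UB mB.
pose P k := `[< exists n, mu (B `&` Bn n) = k%:R%:E >].
have exP : exists k, P k.
  have [k kE] : exists k : nat, mu (B `&` Bn 0%N) = k%:R%:E.
    by apply: pm_nat; rewrite setIC; exact: (lring_setI hX0).
  by exists k; apply/asboolP; exists 0%N.
have muBf : mu B \is a fin_num by rewrite ge0_fin_numE.
have ubP k : P k -> (k <= Num.truncn (fine (mu B)))%N.
  move=> /asboolP[n nE]; rewrite truncn_ge_nat ?fine_ge0//.
  rewrite -lee_fin fineK// -nE; apply: le_measure; rewrite ?inE//.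
  exact: measurableI.
case: (ex_maxnP exP ubP) => k /asboolP[n nE] kmax; exists k.
have <- := cvg_lim (@ereal_hausdorff R) cv; apply: cvg_lim => //.
apply: cvg_near_cst; near=> m.
have [l lE] : exists l : nat, mu (B `&` Bn m) = l%:R%:E.
  by apply: pm_nat; rewrite setIC; exact: (lring_setI hX0).
apply/eqP; rewrite eq_le; apply/andP; split.
  by rewrite lE lee_fin ler_nat; apply: kmax; apply/asboolP; exists m.
rewrite -nE; apply: le_measure; rewrite ?inE; try exact: measurableI.
by apply: setIS; apply/subsetPset/nd; near: m; exists n.
Unshelve. all: by end_near. Qed.

End localising.

(** * Borel spaces: atoms and equality of point measures *)

Section borel.
Context (R : realType) (d : measure_display) (X : measurableType d).
Context (hX : borel_space R X) (X0 : set (set X)) (hX0 : localising_ring X0).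
Notation N := (point_measure R X0).
Implicit Types (mu nu : N) (B : set X).

Lemma borel_measurable_set1 (x : X) : measurable [set x].
Proof.
have [D [f [g [_ [mf _] _ fK _]]]] := hX.
rewrite (_ : [set x] = [set: X] `&` f @^-1` [set f x]).
  by apply: mf => //; exact: measurable_set1.
rewrite setTI; apply/seteqP; split => [y ->//|y /= fyx].
exact: (can_inj fK).
Qed.

Lemma lring_point x : X0 [set x].
Proof. by apply: lring_set1 => //; exact: borel_measurable_set1. Qed.

(** Rational rays are a countable generator stable under intersection; countability is what turns
    [≡μ] into a countable intersection of conditions. *)
Lemma measurable_R_rat_ray :
  @measurable _ (measurableTypeR R) =
  <<s [set `](ratr q : R), +oo[%classic | q in [set: rat]] >>.
Proof.
rewrite [LHS]RGenOInfty.measurableE; apply/seteqP; split; last first.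
  apply: smallest_sub; first exact: smallest_sigma_algebra.
  by move=> _ [q _ <-]; apply: sub_sigma_algebra; exists (ratr q).
apply: smallest_sub; first exact: smallest_sigma_algebra.
move=> _ [r ->]; set G := (X in smallest _ X).
have -> : `]r, +oo[%classic =
    \bigcup_(q : rat) (if (r < ratr q)%R then `]ratr q, +oo[%classic else set0).
  apply/seteqP; split => x /=.
    rewrite in_itv/= andbT => rx; have [q] := rat_in_itvoo rx.
    rewrite in_itv/= => /andP[rq qx]; exists q => //=.
    by rewrite rq /= in_itv/= qx.
  case=> q _; case: ifPn => //= rq; rewrite !in_itv/= !andbT.
  exact: lt_trans.
apply: (@bigcupT_measurable_rat _ (g_sigma_algebraType G)) => q.
case: ifPn => // _; apply: sub_sigma_algebra; by exists q.
Qed.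

(** Pushed to the line by [f], the restrictions to [Bn n] are finite measures agreeing on a
    countable pi-system of rays; letting n grow removes the restriction. *)
Lemma pm_eq_rays (Bn : (set X)^nat) (f : X -> R) (g : R -> X) (D : set R) nu nu' :
  nondecreasing_seq Bn -> (forall n, X0 (Bn n)) ->
  \bigcup_n Bn n = setT ->
  measurable_fun [set: X] f -> measurable D -> (forall x, D (f x)) ->
  measurable_fun D g -> cancel f g ->
  (forall n q, nu (Bn n `&` f @^-1` `]ratr q, +oo[) =
               nu' (Bn n `&` f @^-1` `]ratr q, +oo[)) ->
  nu ≡μ nu'.
Proof.
move=> nd X0B UB mf mD Df mg fK E.
have mBn n : measurable (Bn n) by exact/(lring_measurable hX0).
suff EB n B : measurable B -> nu (B `&` Bn n) = nu' (B `&` Bn n).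
  move=> B mB.
  have h1 := @measure_cvg_exhaustion _ _ _ nu _ _ nd mBn UB mB.
  have h2 := @measure_cvg_exhaustion _ _ _ nu' _ _ nd mBn UB mB.
  have e : (fun n => nu (B `&` Bn n)) = (fun n => nu' (B `&` Bn n)).
    by apply/funext => n; exact: EB.
  rewrite e in h1; exact: (cvg_unique (@ereal_hausdorff R) h1 h2).
move=> mB.
have mray q : measurable (f @^-1` `](ratr q : R), +oo[).
  by rewrite -[X in measurable X]setTI; exact: mf.
pose m := push (mrestr nu (mBn n)) mf; pose m' := push (mrestr nu' (mBn n)) mf.
have mm' : forall A : set R, measurable A -> m A = m' A.
  apply: (measure_unique _ (fun k => `](ratr (- k%:R) : R), +oo[%classic)
           measurable_R_rat_ray).
  - move=> _ _ [p _ <-] [q _ <-]; exists (Num.max p q) => //.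
    apply/seteqP; split => x /=; rewrite !in_itv/= !andbT maxEle.
      by case: ifPn => [pq|]; [|rewrite -ltNge => /ltW pq] => h; split => //;
        apply: le_lt_trans h; rewrite ler_rat.
    by case: ifPn => // _ [].
  - by move=> k; exists (- k%:R)%R.
  - apply/seteqP; split => // x _; exists (Num.truncn `|x|).+1 => //=.
    rewrite in_itv/= andbT rmorphN/= ratr_nat ltrNl.
    by apply: le_lt_trans (truncnS_gt _); rewrite ler_normr lexx orbT.
  - by move=> _ [q _ <-]; rewrite /m /m' /= /pushforward /mrestr ![_ `&` Bn n]setIC.
  - move=> k; rewrite /m /= /pushforward /mrestr; apply: pm_lty.
    by rewrite setIC; exact: (lring_setI hX0).
(* Every measurable set of X is the preimage of a Borel set of the line, so agreement of the
   pushforwards loses nothing. *)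
have BE : B = f @^-1` (D `&` g @^-1` B).
  by apply/seteqP; split => [x Bx|x [_]] /=; rewrite fK.
by have := mm' _ (mg mD _ mB); rewrite /m /m' /= /pushforward /mrestr -BE.
Qed.

(** Measurability of hulls and of [C_] rests on this: both are preimages of the relation [≡μ] under
    measurable maps. *)
Lemma measurable_pm_eq : measurable [set p : N * N | p.1 ≡μ p.2].
Proof.
have [D [f [g [[mD _] [mf Df] mg fK _]]]] := hX.
have [Bn [nd X0B mBn UB]] := lring_cover hX0.
pose V n (q : rat) := Bn n `&` f @^-1` `](ratr q : R), +oo[.
have mV n q : measurable (V n q).
  by apply: measurableI => //; rewrite -[X in measurable X]setTI; exact: mf.
rewrite (_ : [set p | _] = \bigcap_n \bigcap_(q : rat)
    ([set: N * N] `&` [set p : N * N | p.1 (V n q) = p.2 (V n q)])); last first.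
  apply/seteqP; split => [p /= pE n _ q _|p /= pE]; first by split => //; exact: pE.
  apply: (@pm_eq_rays Bn f g D) => // n q.
  by case: (pE n Logic.I q Logic.I).
apply: bigcapT_measurable => n; rewrite -[X in measurable X]setCK setC_bigcap.
apply: measurableC; apply: bigcupT_measurable_rat => q; apply: measurableC.
apply: measurable_eqe => //.
  exact: (measurableT_comp (measurable_pm_ev (mV n q)) measurable_fst).
exact: (measurableT_comp (measurable_pm_ev (mV n q)) measurable_snd).
Qed.

(** Along the levels of [f], the mass of the part of the set below t is an integer, so it jumps from
    0 to at least 1 at the infimum [t0] of the levels with positive mass. The level set at [t0] is a
    single point because [f] is injective. *)
Lemma pm_atom nu B : measurable B -> 0 < nu B ->
  exists2 x, B x & 0 < nu [set x].
Proof.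
move=> mB nuB.
have [D [f [g [[mD D01] [mf Df] mg fK _]]]] := hX.
have [Bn [nd X0B mBn UB]] := lring_cover hX0.
have [n nuBn] : exists n, 0 < nu (B `&` Bn n).
  apply: contrapT => /forallNP h; move: nuB; apply/negP; rewrite -leNgt.
  have cv := @measure_cvg_exhaustion _ _ _ nu _ _ nd mBn UB mB.
  rewrite -(cvg_lim (@ereal_hausdorff R) cv) lime_le//; first exact: cvgP cv.
  by near=> n; rewrite leNgt; apply/negP; exact: h.
pose E := B `&` Bn n.
have mE : measurable E by exact: measurableI.
have XE : X0 E by rewrite /E setIC; exact: (lring_setI hX0).
pose V (I : interval R) := E `&` f @^-1` [set` I].
have mV I : measurable (V I).
  by apply: measurableI => //; apply: (measurableT_preimage mf); exact: measurable_itv.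
have natV I : exists k : nat, nu (V I) = k%:R%:E.
  apply: pm_nat; apply: (lring_setI hX0) => //.
  by apply: (measurableT_preimage mf); exact: measurable_itv.
pose S := [set t : R | 0 < nu (V `]-oo, t])].
have f01 x : (0 <= f x <= 1)%R by have := D01 _ (Df x); rewrite /= in_itv.
have S1 : S 1%R.
  rewrite /S/= (_ : V _ = E)//; apply/setIidl => x _ /=.
  by rewrite in_itv/=; case/andP: (f01 x).
have S0 t : S t -> (0 <= t)%R.
  apply: contraPP => /negP; rewrite -ltNge => t0; rewrite /S/= (_ : V _ = set0).
    by rewrite measure0 ltxx.
  apply/seteqP; split => // x [_] /=; rewrite in_itv/= leNgt => /negP; apply.
  by apply: lt_le_trans t0 _; case/andP: (f01 x).
have iS : has_inf S by split; [exists 1%R|exists 0%R].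
pose t0 := inf S.
have Vlt : nu (V `]-oo, t0[) = 0.
  have -> : V `]-oo, t0[ = \bigcup_k V `]-oo, (t0 - k.+1%:R^-1)%R].
    apply/seteqP; split => x [].
      move=> Ex /=; rewrite in_itv/= => ft.
      have d0 : (0 < t0 - f x)%R by rewrite subr_gt0.
      exists (Num.truncn (t0 - f x)^-1) => //; split => //=; rewrite in_itv/=.
      rewrite lerBrDl -lerBrDr invf_ple ?posrE// ltW//.
      exact: truncnS_gt.
    move=> k _ [Ex /=]; rewrite !in_itv/= => h; split => //=; rewrite in_itv/=.
    by apply: le_lt_trans h _; rewrite ltrBlDr ltrDl.
  apply/eqP; rewrite eq_le measure_ge0 andbT.
  apply: (le_trans (measure_sigma_subadditive _ _ _ (@subset_refl _ _))) => //.
    exact: bigcupT_measurable.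
  rewrite eseries0// => k _ _; apply/eqP; rewrite eq_le measure_ge0 andbT leNgt.
  apply/negP => Sk; have : (t0 <= t0 - k.+1%:R^-1)%R.
    by apply: ge_inf => //; case: iS.
  by rewrite leNgt ltrBlDr ltrDl invr_gt0 ltr0n.
(* A positive integer is at least 1, and this bound, unlike positivity, survives the limit from the
   right. *)
have Vle : 1 <= nu (V `]-oo, t0]).
  have -> : V `]-oo, t0] = \bigcap_k V `]-oo, (t0 + k.+1%:R^-1)%R].
    apply/seteqP; split => x.
      move=> [Ex /=]; rewrite in_itv/= => ft k _; split => //=; rewrite in_itv/=.
      by apply: le_trans ft _; rewrite lerDl invr_ge0.
    move=> h; split; first by case: (h 0%N Logic.I).
    rewrite /= in_itv/= leNgt; apply/negP => tf.
    have d0 : (0 < f x - t0)%R by rewrite subr_gt0.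
    case: (h (Num.truncn (f x - t0)^-1) Logic.I) => _ /=; rewrite in_itv/=.
    rewrite leNgt => /negP; apply; rewrite -ltrBrDl invf_plt ?posrE//.
    exact: truncnS_gt.
  (* Continuity from above needs finite mass, which is why the set was first cut down to some
     [Bn n]. *)
  have cv : nu (V `]-oo, (t0 + k.+1%:R^-1)%R]) @[k --> \oo] -->
      nu (\bigcap_k V `]-oo, (t0 + k.+1%:R^-1)%R]).
    apply: nonincreasing_cvg_mu => //.
    - by have [k ->] := natV `]-oo, (t0 + 1%N%:R^-1)%R]; rewrite ltry.
    - exact: bigcapT_measurable.
    - move=> i j ij; apply/subsetPset; apply: setIS => x /=; rewrite !in_itv/=.
      by move/le_trans; apply; rewrite lerD2l lef_pV2 ?posrE// ler_nat.
  rewrite -(cvg_lim (@ereal_hausdorff R) cv) lime_ge//; first exact: cvgP cv.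
  near=> k; have [s Ss st] : exists2 s, S s & (s < t0 + k.+1%:R^-1)%R.
    by apply: inf_adherent.
  have [j jE] := natV `]-oo, (t0 + k.+1%:R^-1)%R]; rewrite jE lee_fin ler1n.
  rewrite lt0n; apply/eqP => j0; move: jE; rewrite j0 => jE.
  move: Ss; rewrite /S/= ltNge => /negP; apply.
  apply: (@le_trans _ _ (nu (V `]-oo, (t0 + k.+1%:R^-1)%R]))); last by rewrite jE.
  apply: le_measure; rewrite ?inE//; apply: setIS => x /=.
  by rewrite !in_itv/= => /le_trans; apply; exact: ltW.
have pos : 0 < nu (E `&` f @^-1` [set t0]).
  have VE : V `]-oo, t0] = V `]-oo, t0[ `|` (E `&` f @^-1` [set t0]).
    rewrite /V -setIUr; congr (_ `&` _); apply/seteqP; split => x /=; rewrite !in_itv/=.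
      by rewrite le_eqVlt => /orP[/eqP|]; [right|left].
    by case=> [/ltW//|->].
  have mE0 : measurable (E `&` f @^-1` [set t0]).
    by apply: measurableI => //; rewrite -[X in measurable X]setTI; exact: mf.
  apply: (@lt_le_trans _ _ 1) => //; apply: (le_trans Vle); rewrite VE.
  have /= := measureU2 nu (mV `]-oo, t0[) mE0; rewrite Vlt.
  by rewrite add0e.
have [x [Ex fx]] : (E `&` f @^-1` [set t0]) !=set0.
  by apply/set0P; apply: contraTneq pos => ->; rewrite measure0 ltxx.
exists x; first by case: Ex.
rewrite (_ : [set x] = E `&` f @^-1` [set t0])//.
apply/seteqP; split => y; first by move=> ->.
by move=> [_ /= fy]; apply: (can_inj fK); rewrite fx fy.
Unshelve. all: by end_near. Qed.

End borel.

(** * Differences of point measures *)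

Section measure_difference.
Context (R : realType) (d : measure_display) (X : measurableType d).
Context (m m' : {measure set X -> \bar R}).
Hypothesis m'm : measure_le m' m.
Hypothesis mfin : m [set: X] < +oo.

Let mfinB B : measurable B -> m B \is a fin_num.
Proof.
move=> mB; rewrite ge0_fin_numE//; apply: le_lt_trans mfin.
by apply: le_measure; rewrite ?inE.
Qed.

Let m'finB B : measurable B -> m' B \is a fin_num.
Proof.
move=> mB; rewrite ge0_fin_numE//; apply: le_lt_trans (m'm mB) _.
by rewrite -ge0_fin_numE// mfinB.
Qed.

(** The maximum with 0 matters only off the measurable sets, where [m'] may exceed [m] although a
    measure must be nonnegative everywhere. *)
Definition mdiff (A : set X) : \bar R := maxe 0 (m A - m' A).

Lemma mdiffE B : measurable B -> mdiff B = m B - m' B.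
Proof.
by move=> mB; apply/max_idPr; rewrite sube_ge0 ?m'finB ?orbT//; exact: m'm.
Qed.

Let mdiff0 : mdiff set0 = 0.
Proof. by rewrite mdiffE// !measure0 sube0. Qed.

Let mdiff_ge0 A : 0 <= mdiff A.
Proof. by rewrite le_max lexx. Qed.

Let mdiff_sigma_additive : semi_sigma_additive mdiff.
Proof.
move=> F mF tF mUF; rewrite mdiffE//.
have cm := @measure_semi_sigma_additive _ _ _ m F mF tF mUF.
have cm' := @measure_semi_sigma_additive _ _ _ m' F mF tF mUF.
rewrite (_ : (fun n => _) = (fun n => \sum_(0 <= i < n) m (F i)) \-
                            (fun n => \sum_(0 <= i < n) m' (F i))).
  by apply: cvgeB => //; rewrite fin_num_adde_defl// fin_numN m'finB.
apply/funext => n /=; rewrite -fin_num_sumeN; last by move=> i _; exact: m'finB.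
by rewrite -big_split; apply: eq_bigr => i _; exact: mdiffE.
Qed.

HB.instance Definition _ := isMeasure.Build _ _ _ mdiff
  mdiff0 mdiff_ge0 mdiff_sigma_additive.

Lemma measure_difference : exists m'' : {measure set X -> \bar R},
  forall B, measurable B -> m' B + m'' B = m B.
Proof.
exists mdiff => B mB; rewrite [X in _ + X]mdiffE//.
by rewrite addeC subeK// m'finB.
Qed.

End measure_difference.

Section pm_difference.
Context (R : realType) (d : measure_display) (X : measurableType d).
Context (X0 : set (set X)) (hX0 : localising_ring X0).
Notation N := (point_measure R X0).
Implicit Types (mu nu : N) (B : set X).

Lemma measure_seqDU (m : {measure set X -> \bar R}) (Bn : (set X)^nat) B :
  (forall n, measurable (Bn n)) -> \bigcup_n Bn n = setT -> measurable B ->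
  m B = \sum_(n <oo) m (B `&` seqDU Bn n).
Proof.
move=> mBn UB mB; rewrite -[in LHS](setIT B) -UB seqDU_bigcup_eq setI_bigcupr.
have mS n : measurable (seqDU Bn n).
  by apply: measurableD => //; exact: bigsetU_measurable.
rewrite measure_bigcup//=.
- by apply: eq_eseriesl => n; rewrite in_setT.
- by move=> n _; exact: measurableI.
- by apply: trivIset_setIl; exact: trivIset_seqDU.
Qed.

(** Infinite masses cannot be subtracted, so the difference is taken on the disjoint pieces of an
    exhaustion, where it is finite, and summed. This supplies the measure mu - del mu that the
    idempotency axiom refers to. *)
Lemma pm_difference mu nu : measure_le nu mu ->
  exists rho : N, pm_add nu rho ≡μ mu.
Proof.
move=> numu; have [Bn [nd X0B mBn UB]] := lring_cover hX0.
have mC n : measurable (seqDU Bn n).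
  by apply: measurableD => //; exact: bigsetU_measurable.
have XC n : X0 (seqDU Bn n).
  by rewrite /seqDU setDE; apply: (lring_setI hX0) => //;
    apply: measurableC; exact: bigsetU_measurable.
have /choice[r rE] n : exists r : {measure set X -> \bar R}, forall B, measurable B ->
    mrestr nu (mC n) B + r B = mrestr mu (mC n) B.
  apply: measure_difference.
  - by move=> B mB; apply: numu; exact: measurableI.
  - by rewrite /= /mrestr setTI; exact: pm_lty.
pose rho : {measure set X -> \bar R} := mseries r 0.
have rhoE B : measurable B -> nu B + rho B = mu B.
  move=> mB; rewrite (measure_seqDU nu mBn UB mB) (measure_seqDU mu mBn UB mB).
  rewrite /rho /= /mseries -nneseriesD//.
  by apply: eq_eseriesr => n _; exact: rE.
have rho_nat B : X0 B -> exists k : nat, rho B = k%:R%:E.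
  move=> XB; have [k kE] := pm_nat mu XB; have [l lE] := pm_nat nu XB.
  have mB : measurable B by exact/(lring_measurable hX0).
  have := rhoE B mB; rewrite kE lE => h; exists (k - l)%N.
  have lk : (l <= k)%N.
    by have := numu B mB; rewrite kE lE lee_fin ler_nat.
  rewrite natrB// EFinB -h addeAC subee ?add0e//.
by exists (PointMeasure rho_nat) => B mB; rewrite pm_addE rhoE.
Qed.

End pm_difference.

(** * Generators and hulls *)

Section generator_theory.
Context (R : realType) (d : measure_display) (X : measurableType d).
Context (hX : borel_space R X) (X0 : set (set X)) (hX0 : localising_ring X0).
Notation N := (point_measure R X0).
Context (del : N -> N) (hdel : generator del).
Implicit Types (mu nu phi psi rho : N) (x : X) (B : set X).

Notation "mu ⊕ x" := (pm_add mu (pm_dirac R X0 x)) (at level 50).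

Lemma del_eq mu nu : mu ≡μ nu -> del mu ≡μ del nu.
Proof. exact: measurable_fun_pm_eq (gen_measurable hdel). Qed.

Lemma del_add_eq mu nu psi : mu ≡μ nu -> del (pm_add mu psi) ≡μ del (pm_add nu psi).
Proof. by move=> e; apply: del_eq => S mS; rewrite !pm_addE e. Qed.

Lemma del_idem mu : del (del mu) ≡μ del mu.
Proof.
have [rho rhoE] := pm_difference hX0 (gen_thinning hdel mu).
have : del (pm_add (del mu) (pm_zero X0)) ≡μ del mu.
  by apply: (gen_idempotent hdel rhoE) => B mB; exact: measure_ge0.
move=> h S mS; rewrite -h//; apply: del_eq => // B mB.
by rewrite pm_addE [X in _ + X](_ : _ = 0)// adde0.
Qed.

Lemma hull_eq mu nu : mu ≡μ nu -> hull del mu = hull del nu.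
Proof.
move=> e; apply/seteqP; split => x /= h S mS.
  by rewrite -(del_add_eq _ e mS) h// (del_eq e mS).
by rewrite (del_add_eq _ e mS) h// -(del_eq e mS).
Qed.

(** Consistency applies to [del mu] and [mu], which have the same selection: adding a point has the
    same effect on both. The hull is thus a function of the selection alone, which is what makes it
    available after conditioning on the selection. *)
Lemma hull_del mu : hull del (del mu) = hull del mu.
Proof.
have e : del mu ≡μ del (del mu) by move=> S mS; rewrite del_idem.
have c := gen_consistent hdel (gen_thinning hdel mu) e.
apply/seteqP; split => x /= h S mS.
  by rewrite c// h// del_idem.
by rewrite -c// h// e.
Qed.

Lemma measurable_hull_pair : measurable [set p : N * X | hull del p.1 p.2].
Proof.
have mf : measurable_fun [set: N * X] (fun p : N * X => (del (p.1 ⊕ p.2), del p.1)).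
  apply: measurable_fun_pair => /=.
    exact: (measurableT_comp (gen_measurable hdel) (@measurable_add_dirac R d X X0)).
  exact: (measurableT_comp (gen_measurable hdel) measurable_fst).
by have := mf measurableT _ (measurable_pm_eq hX hX0); rewrite setTI.
Qed.

Lemma measurable_hull mu : measurable (hull del mu).
Proof.
have -> : hull del mu = xsection [set p : N * X | hull del p.1 p.2] mu.
  by apply/seteqP; split => x; rewrite /xsection /= inE.
by apply: measurable_xsection; exact: measurable_hull_pair.
Qed.

(** Otherwise additivity would equate the mass of [x] in [del mu] with that mass plus 1; it is
    finite because points belong to the ring. *)
Lemma del_notin_hull mu x : 0 < del mu [set x] -> ~ hull del mu x.
Proof.
move=> px hx; have m1 := borel_measurable_set1 hX x.
have := gen_additive hdel px m1; rewrite hx// pm_addE.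
have /(pm_nat (del mu))[k ->] := lring_point hX hX0 x.
rewrite /= diracE mem_set//= -EFinD => -[] /esym/eqP.
by rewrite -subr_eq0 addrAC subrr add0r oner_eq0.
Qed.

Lemma pm_DI mu B D : measurable B -> measurable D ->
  mu B = mu (B `\` D) + mu (B `&` D).
Proof. exact: measureDI. Qed.

Lemma pm_null mu B : measurable B -> (forall x, 0 < mu [set x] -> ~ B x) -> mu B = 0.
Proof.
move=> mB h; apply: contrapT => /eqP B0.
have [|x Bx] := pm_atom hX hX0 mB (nu := mu); first by rewrite lt0e B0 measure_ge0.
by move=> /h; exact.
Qed.

Lemma del_hull mu : del mu (hull del mu) = 0.
Proof. apply: pm_null; [exact: measurable_hull|exact: del_notin_hull]. Qed.

Lemma dirac_le mu x : 0 < mu [set x] -> measure_le (pm_dirac R X0 x) mu.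
Proof.
move=> px B mB; have m1 := borel_measurable_set1 hX x.
have [k kE] := pm_nat mu (lring_point hX hX0 x).
rewrite /= diracE; have [xB|_] := boolP (x \in B); last exact: measure_ge0.
apply: (@le_trans _ _ (mu [set x])).
  by move: px; rewrite kE lte_fin lee_fin ltr0n ler1n.
by apply: le_measure; rewrite ?inE// => _ ->; rewrite inE in xB.
Qed.

(** By idempotency a point of the remainder can be added to [del mu] without changing the selection,
    so it lies in the hull of [del mu], which is that of [mu]. *)
Lemma rest_hullC mu rho : pm_add (del mu) rho ≡μ mu -> rho (~` hull del mu) = 0.
Proof.
move=> rhoE; apply: pm_null; first by apply: measurableC; exact: measurable_hull.
move=> x px; apply; rewrite -hull_del /=.
move=> S mS; rewrite (gen_idempotent hdel rhoE (dirac_le px))//.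
by rewrite del_idem.
Qed.

Lemma delE mu B : measurable B -> del mu B = mu (B `\` hull del mu).
Proof.
move=> mB; have mh := measurable_hull mu.
have [rho rhoE] := pm_difference hX0 (gen_thinning hdel mu).
have mBh : measurable (B `\` hull del mu) by exact: measurableD.
rewrite -rhoE// pm_addE.
have -> : rho (B `\` hull del mu) = 0.
  apply/eqP; rewrite eq_le measure_ge0 andbT -(rest_hullC rhoE).
  by apply: le_measure; rewrite ?inE//; exact: measurableC.
rewrite adde0 (pm_DI (del mu) mB mh).
have -> : del mu (B `&` hull del mu) = 0; last by rewrite adde0.
apply/eqP; rewrite eq_le measure_ge0 andbT -(del_hull mu).
by apply: le_measure; rewrite ?inE//; exact: measurableI.
Qed.

Lemma measure_leD mu nu : measure_le mu (pm_add mu nu).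
Proof. by move=> B mB; rewrite pm_addE leeDl. Qed.

(* No point of [phi + nu] lying in [hull phi] can be selected: additivity would
   add it to the selection, while consistency says that it changes nothing. *)
Lemma del_addr phi nu : del phi ≡μ phi -> nu (~` hull del phi) = 0 ->
  del (pm_add phi nu) ≡μ phi.
Proof.
move=> pE n0; set mu := pm_add phi nu.
have mh := measurable_hull phi.
have dh : del mu (hull del phi) = 0.
  apply: pm_null => // y py hy.
  have c := gen_consistent hdel (measure_leD phi (pm_dirac R X0 y)) hy nu.
  have e : pm_add (phi ⊕ y) nu ≡μ mu ⊕ y.
    by move=> S mS; rewrite !pm_addE addeAC.
  have m1 := borel_measurable_set1 hX y.
  have := gen_additive hdel py m1; rewrite -(del_eq e m1) (c _ m1) pm_addE.
  have /(pm_nat (del mu))[k kE] := lring_point hX hX0 y.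
  rewrite kE /= diracE mem_set//= -EFinD => -[] /esym/eqP.
  by rewrite -subr_eq0 addrAC subrr add0r oner_eq0.
have null (m : N) B D : measurable B -> measurable D -> m D = 0 -> m (B `&` D) = 0.
  move=> mB mD mD0; apply/eqP; rewrite eq_le measure_ge0 andbT -mD0.
  by apply: le_measure; rewrite ?inE//; exact: measurableI.
have dle : measure_le (del mu) phi.
  move=> B mB.
  rewrite (pm_DI (del mu) mB mh) null// adde0 (pm_DI phi mB mh).
  apply: le_trans (gen_thinning hdel mu (measurableD mB mh)) _.
  by rewrite pm_addE setDE (null nu)// ?adde0 ?leeDl//; exact: measurableC.
have [rho rhoE] := pm_difference hX0 dle.
have e : pm_add (del mu) (pm_add rho nu) ≡μ mu.
  by move=> S mS; rewrite !pm_addE addeA -(rhoE S mS) pm_addE.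
(* The part discarded from [mu] is [rho + nu]. Adding back only [rho] rebuilds [phi], which is its
   own selection. *)
have h := gen_idempotent hdel e (measure_leD rho nu).
by move=> S mS; rewrite -h// (del_eq rhoE)// pE.
Qed.

(** For the direct implication, [phi] is a selection, hence fixed by [del], and it has the hull of
    the sum. By [delE] a point of [nu] outside this hull would be selected with its full mass in
    [phi + nu], more than its mass in [phi]. *)
Lemma del_addP phi nu : del (pm_add phi nu) ≡μ phi <->
  del phi ≡μ phi /\ nu (~` hull del phi) = 0.
Proof.
split; last by case; exact: del_addr.
set mu := pm_add phi nu => muE.
have pE : del phi ≡μ phi.
  by move=> S mS; rewrite -(del_eq muE)// del_idem// muE.
split => //.
have hE : hull del mu = hull del phi by rewrite -hull_del (hull_eq muE).
have mh := measurable_hull phi.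
apply: pm_null; first exact: measurableC.
move=> x px hx; have m1 := borel_measurable_set1 hX x.
have x1 : [set x] `\` hull del phi = [set x].
  by apply/seteqP; split => [y []|y ->].
have := muE _ m1; rewrite (delE _ m1) hE x1 pm_addE.
have [k ->] := pm_nat phi (lring_point hX hX0 x).
have [l lE] := pm_nat nu (lring_point hX hX0 x).
move: px; rewrite lE lte_fin -EFinD => l0 -[] /eqP.
by rewrite -subr_eq0 addrAC subrr add0r (gt_eqF l0).
Qed.

End generator_theory.

(** * Kernels and mixtures *)

Section point_measure_integrals.
Context (R : realType) (d dS : measure_display) (X : measurableType d)
  (S : measurableType dS).
Context (X0 : set (set X)) (hX0 : localising_ring X0).
Notation N := (point_measure R X0).
Context (nu : S -> N) (mnu : measurable_fun [set: S] nu).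

Let ker (s : S) : {measure set X -> \bar R} := nu s.

Let measurable_ker B : measurable B -> measurable_fun [set: S] (ker ^~ B).
Proof. by move=> mB; exact: (measurableT_comp (measurable_pm_ev mB) mnu). Qed.

HB.instance Definition _ := isKernel.Build _ _ _ _ _ ker measurable_ker.

(** The measures [nu s] may be infinite, so the section theorem for kernels is applied to their
    restrictions to [Bn n], followed by a monotone limit. *)
Lemma measurable_pm_xsection (E : set (S * X)) : measurable E ->
  measurable_fun [set: S] (fun s => nu s (xsection E s)).
Proof.
move=> mE; have [Bn [nd X0B mBn UB]] := lring_cover hX0.
apply: (emeasurable_fun_cvg (fun n s => nu s (xsection E s `&` Bn n))).
  move=> n.
  suff h : forall s, exists M, forall B, measurable B -> mrestr (ker s) (mBn n) B < M%:E.
    exact: (proj2 (@measurable_prod_subset_xsection_kernel _ _ S X R ker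
      (Bn n) (mBn n) h E mE)).
  move=> s; have [k kE] := pm_nat (nu s) (X0B n).
  exists (k%:R + 1)%R => B mB; rewrite /mrestr (@le_lt_trans _ _ (nu s (Bn n)))//.
    by apply: le_measure; rewrite ?inE//; exact: measurableI.
  by rewrite kE lte_fin ltrDl.
move=> s _; exact: (@measure_cvg_exhaustion _ _ _ (nu s) Bn _ nd mBn UB
  (measurable_xsection s mE)).
Qed.

End point_measure_integrals.

Section mixture.
Context (R : realType) (dS dZ : measure_display) (S : measurableType dS)
  (Z : measurableType dZ).
Import HBNNSimple.
Context (m : {measure set S -> \bar R}) (k : S -> {measure set Z -> \bar R}).
Hypothesis mk : forall U, measurable U -> measurable_fun [set: S] (k ^~ U).

(** The composition of the measure [m] with the kernel [k]. Both sides of Mecke's equation are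
    integrals against measures of this kind. *)
Definition mixture (U : set Z) : \bar R := \int[m]_s k s U.

Let mixture0 : mixture set0 = 0.
Proof. by apply: integral0_eq => s _; rewrite measure0. Qed.

Let mixture_ge0 U : 0 <= mixture U.
Proof. exact: integral_ge0. Qed.

Let mixture_sigma_additive : semi_sigma_additive mixture.
Proof.
move=> F mF tF mUF; rewrite [X in _ --> X](_ : _ = \sum_(n <oo) mixture (F n)).
  by apply: is_cvg_nneseries => n _ _; exact: integral_ge0.
rewrite /mixture -integral_nneseries//; last by move=> n; exact: mk.
by apply: eq_integral => s _; exact: measure_semi_bigcup.
Qed.

HB.instance Definition _ := isMeasure.Build _ _ _ mixture
  mixture0 mixture_ge0 mixture_sigma_additive.

Definition mixture_measure : {measure set Z -> \bar R} := mixture.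

Let nnsfun_mixture (f : {nnsfun Z >-> R}) :
  \int[mixture]_z (f z)%:E = \int[m]_s \int[k s]_z (f z)%:E.
Proof.
rewrite integralT_nnsfun sintegralE.
under [RHS]eq_integral do rewrite integralT_nnsfun sintegralE.
rewrite ge0_integral_fsum//.
- apply: eq_fsbigr => r _; rewrite /mixture.
  have [r0|r0] := leP 0%R r.
    by rewrite ge0_integralZl//; exact: mk.
  have E s : k s (f @^-1` [set r]) = 0 by rewrite preimage_nnfun0// measure0.
  transitivity (0 : \bar R); last by apply/esym/integral0_eq => s _; rewrite E mule0.
  by rewrite [X in _ * X](_ : _ = 0) ?mule0//; apply: integral0_eq.
- by move=> r; apply: measurable_funeM; exact: mk.
- by move=> r s _; exact: nnsfun_mulemu_ge0.
Qed.

Lemma integral_mixture (f : Z -> \bar R) : (forall z, 0 <= f z) ->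
  measurable_fun [set: Z] f -> \int[mixture]_z f z = \int[m]_s \int[k s]_z f z.
Proof.
move=> f0 mf; pose f_ := nnsfun_approx measurableT mf.
have ndf z a b : (a <= b)%N -> (f_ a z)%:E <= (f_ b z)%:E.
  by move=> ab; rewrite lee_fin; have /lefP/(_ z) := nd_nnsfun_approx measurableT mf ab.
have mcv (mu : {measure set Z -> \bar R}) :
    \int[mu]_z f z = limn (fun n => \int[mu]_z (f_ n z)%:E).
  rewrite -monotone_convergence//.
  - by apply: eq_integral => z _; apply/esym/cvg_lim => //; exact: cvg_nnsfun_approx.
  - by move=> n; exact/measurable_EFinP.
  - by move=> n z _; rewrite lee_fin.
  - by move=> z _ a b; exact: ndf.
rewrite mcv; under eq_fun do rewrite nnsfun_mixture.
rewrite -monotone_convergence//.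
- by apply: eq_integral => s _; rewrite mcv.
- move=> n; apply: measurable_fun_integral_kernel => //.
  by move=> z; rewrite lee_fin.
  exact/measurable_EFinP.
- by move=> n s _; apply: integral_ge0 => z _; rewrite lee_fin.
- move=> s _ a b ab; apply: ge0_le_integral => //.
  + by move=> z _; rewrite lee_fin.
  + exact/measurable_EFinP.
  + exact/measurable_EFinP.
  + by move=> z _; exact: ndf.
Qed.

End mixture.

(** * Finite-dimensional distributions *)

Section finite_unions.
Context (R : realType) (d : measure_display) (X : measurableType d).

Lemma measure_fin_disjoint (m : {measure set X -> \bar R}) (S : finType)
    (D : S -> set X) (P : pred S) :
  (forall s, measurable (D s)) -> trivIset [set: S] D ->
  m [set x | exists2 s, P s & D s x] = \sum_(s | P s) m (D s).
Proof.
move=> mD tD.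
have -> : [set x | exists2 s, P s & D s x] = \bigcup_(s in [set` P]) D s.
  by apply/seteqP; split => x [s]; exists s.
rewrite measure_fin_bigcup//.
- by rewrite [RHS]bigfs ?index_enum_uniq// => s _; rewrite mem_index_enum.
- exact: sub_trivIset tD.
Qed.

Lemma fin_forall_measurable d' (T : measurableType d') (S : finType) (A : S -> set T) :
  (forall s, measurable (A s)) -> measurable [set x | forall s, A s x].
Proof.
move=> mA; rewrite (_ : [set x | _] = \bigcap_(s in [set: S]) A s).
  by apply: fin_bigcap_measurable => // ; exact: finite_finset.
by apply/seteqP; split => [x h s _|x h s]; exact: h.
Qed.

End finite_unions.

Lemma EFin_natI (R : realType) : injective (fun n : nat => n%:R%:E : \bar R).
Proof. by move=> m n [] /eqP; rewrite eqr_nat => /eqP. Qed.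

Section finite_dimensional.
Context (R : realType) (d : measure_display) (X : measurableType d).
Context (X0 : set (set X)) (hX0 : localising_ring X0).
Notation N := (point_measure R X0).

Definition pm_box (T : finType) (C : T -> set X) (k : T -> nat) : set N :=
  [set mu | forall t, mu (C t) = (k t)%:R%:E].

Lemma measurable_pm_box (T : finType) (C : T -> set X) (k : T -> nat) :
  (forall t, measurable (C t)) -> measurable (pm_box C k).
Proof.
move=> mC; apply: fin_forall_measurable => t.
exact: (measurableT_preimage (measurable_pm_ev (X0 := X0) (mC t))
  (emeasurable_set1 (k t)%:R%:E)).
Qed.

Definition pm_boxes : set (set N) := [set E | exists (T : finType) C k,
  (forall t : T, X0 (C t)) /\ E = pm_box C k].

Lemma pm_boxes_measurable : pm_boxes `<=` measurable.
Proof.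
move=> _ [T [C [k [XC ->]]]]; apply: measurable_pm_box => t.
exact/(lring_measurable hX0).
Qed.

Lemma pm_boxesI : setI_closed pm_boxes.
Proof.
move=> _ _ [T [C [k [XC ->]]]] [T' [C' [k' [XC' ->]]]].
exists (T + T')%type.
exists (fun z => match z with inl t => C t | inr t => C' t end).
exists (fun z => match z with inl t => k t | inr t => k' t end).
split; first by case.
apply/seteqP; split => [mu [h h'] [t|t]|mu h]; [exact: h|exact: h'|].
by split=> t; [exact: (h (inl t))|exact: (h (inr t))].
Qed.

Lemma pm_boxesT : pm_boxes setT.
Proof.
exists void, (fun z : void => match z with end), (fun z : void => match z with end).
by split; [case|apply/seteqP; split => // mu _ []].
Qed.

(** On a ring set the count is an integer, so its evaluation is measurable as soon as the countably
    many events of a prescribed count are; other evaluations are limits along an exhaustion. *)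
Lemma pm_measurable_boxes : @measurable _ N = <<s pm_boxes >>.
Proof.
apply/seteqP; split; last first.
  apply: smallest_sub; first exact: sigma_algebra_measurable.
  exact: pm_boxes_measurable.
have [Bn [nd X0B mBn UB]] := lring_cover hX0.
pose N' : measurableType _ := g_sigma_algebraType pm_boxes.
have mev0 C : X0 C -> measurable_fun [set: N'] (fun mu : N => mu C).
  move=> XC _ A mA; rewrite setTI.
  have -> : (fun mu : N => mu C) @^-1` A =
      \bigcup_k (if k%:R%:E \in A then [set mu : N | mu C = k%:R%:E] else set0).
    apply/seteqP; split => mu /=.
      by have [k kE] := pm_nat mu XC; rewrite kE => Ak; exists k => //; rewrite mem_set.
    by move=> [k _]; case: ifPn => //=; rewrite inE => ? ->.
  apply: bigcupT_measurable => k; case: ifPn => // _.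
  apply: sub_sigma_algebra; exists unit, (fun=> C), (fun=> k); split => //.
  by apply/seteqP; split => [mu h []//|mu h]; exact: (h tt).
have mev C : measurable C -> measurable_fun [set: N'] (fun mu : N => mu C).
  move=> mC.
  apply: (emeasurable_fun_cvg (fun n (mu : N') => (mu : N) (C `&` Bn n))).
    by move=> n; apply: mev0; rewrite setIC; exact: (lring_setI hX0).
  move=> mu _.
  exact: (@measure_cvg_exhaustion _ _ _ (mu : N) Bn _ nd mBn UB mC).
apply: smallest_sub; first exact: smallest_sigma_algebra.
move=> _ [C mC [Z mZ <-]].
exact: (mev C mC measurableT Z mZ).
Qed.

(* Any box is a countable disjoint union of boxes over the atoms of the finite
   algebra generated by its sides and [B]. *)
Lemma pm_measure_unique (M M' : {measure set N -> \bar R}) (B : set X) :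
  X0 B -> M setT < +oo ->
  (forall (S : finType) (D : S -> set X) (l : S -> nat),
    (forall s, X0 (D s)) -> trivIset [set: S] D ->
    (exists J : pred S, B = [set x | exists2 s, J s & D s x]) ->
    M (pm_box D l) = M' (pm_box D l)) ->
  forall A, measurable A -> M A = M' A.
Proof.
move=> XB Mfin MM'.
apply: (measure_unique pm_boxes (fun=> setT) pm_measurable_boxes pm_boxesI).
- by move=> _; exact: pm_boxesT.
- by apply/seteqP; split => // x _; exists 0%N.
- move=> _ [T [C [k [XC ->]]]].
  (* [B] joins the sides of the box so that it becomes a union of cells, and [mu B] a function of
     the prescribed counts. *)
  pose C' (o : option T) := if o is Some t then C t else B.
  have XC' o : X0 (C' o) by case: o => /=.
  pose sig x : {set option T} := [set o | `[< C' o x >]]%SET.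
  (* A cell is the set of points lying in exactly the sides listed by [s]. The empty list is
     excluded because the outside of all sides need not belong to the ring. *)
  pose D (s : {set option T}) := [set x | sig x = s /\ s != finset.set0].
  have sigP x o : (o \in sig x) <-> C' o x.
    by rewrite inE; split => [/asboolP|?]//; exact/asboolP.
  have mD s : measurable (D s).
    have [s0|s0] := eqVneq s finset.set0.
      rewrite (_ : D s = set0)//; apply/seteqP; split => // x [_].
      by rewrite s0 eqxx.
    rewrite (_ : D s = [set x | forall o,
        (if o \in s then C' o else ~` C' o) x]); last first.
      apply/seteqP; split => [x [<- _] o|x h].
        by case: ifPn => [/sigP//|os]; move=> /sigP; exact/negP.
      split => //; apply/setP => o; have := h o; case: ifPn => os.
        by move/sigP ->.
      by move=> nC; apply/negP => /sigP.
    apply: fin_forall_measurable => o.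
    by case: ifP => _; [|apply: measurableC]; exact/(lring_measurable hX0).
  have XD s : X0 (D s).
    have [s0|[u us]] := set_0Vmem s.
      rewrite (_ : D s = set0); first exact: (lring0 hX0).
      by apply/seteqP; split => // x [_]; rewrite s0 eqxx.
    rewrite (_ : D s = C' u `&` D s); first exact: (lring_setI hX0).
    apply/esym/setIidr => x [sx _]; apply/sigP; by rewrite sx.
  have tD : trivIset [set: {set option T}] D.
    by move=> s s' _ _ [x [[<- _] [<- _]]].
  have C'E o : C' o = [set x | exists2 s : {set option T}, o \in s & D s x].
    apply/seteqP; split => [x /sigP ox|x [s os [sx _]]].
      exists (sig x) => //; split => //; apply/set0Pn; by exists o.
    by apply/sigP; rewrite sx.
  have muC' (mu : N) (l : {set option T} -> nat) o : pm_box D l mu ->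
      mu (C' o) = (\sum_(s : {set option T} | o \in s) l s)%N%:R%:E.
    move=> h; rewrite [in LHS]C'E measure_fin_disjoint//.
    under eq_bigr do rewrite h.
    by rewrite sumEFin natr_sum.
  pose good (l : {ffun {set option T} -> nat}) :=
    [forall t, (\sum_(s : {set option T} | Some t \in s) l s)%N == k t].
  (* Cell counts are enumerated through their codes; a number that is no code, or whose counts do
     not add up to [k], contributes the empty set. *)
  pose F n := if pickle_inv n is Some l then
    (if good l then pm_box D l else set0) else set0.
  have FE : pm_box C k = \bigcup_n F n.
    apply/seteqP; split => mu.
      move=> h.
      have /choice[l lE] s : exists j : nat, mu (D s) = j%:R%:E by exact: pm_nat.
      pose l' : {ffun {set option T} -> nat} := [ffun s => l s].
      have bl : pm_box D l' mu by move=> s; rewrite ffunE lE.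
      exists (pickle l') => //; rewrite /F pickleK_inv ifT//.
      apply/forallP => t; apply/eqP/(@EFin_natI R); by rewrite -(muC' mu) //= h.
    move=> [n _]; rewrite /F; case: pickle_inv => // l; case: ifPn => // /forallP gl bl t.
    by have /= -> := muC' mu l (Some t) bl; rewrite (eqP (gl t)).
  have tF : trivIset [set: nat] F.
    move=> n n' _ _ [mu []]; rewrite /F.
    case nE : pickle_inv => [l|//]; case: ifPn => // _ bl.
    case nE' : pickle_inv => [l'|//]; case: ifPn => // _ bl'.
    have ll' : l = l'.
      by apply/ffunP => s; apply: (@EFin_natI R); rewrite -bl -bl'.
    have := @pickle_invK {ffun {set option T} -> nat} n.
    have := @pickle_invK {ffun {set option T} -> nat} n'.
    by rewrite nE nE' /= ll' => -> ->.
  have mF n : measurable (F n).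
    rewrite /F; case: pickle_inv => // l; case: ifPn => // _.
    exact: measurable_pm_box.
  rewrite FE !measure_bigcup//; apply: eq_eseriesr => n _.
  rewrite /F; case: pickle_inv => [l|]; last by rewrite !measure0.
  case: ifPn => _; last by rewrite !measure0.
  apply: MM' => //.
  by exists [pred s : {set option T} | None \in s]; exact: (C'E None).
- by [].
Qed.

End finite_dimensional.

(** * Poisson processes *)

Section law.
Context (R : realType) (dO dT : measure_display) (Omega : measurableType dO)
  (T : measurableType dT).
Context (P : probability Omega R) (phi : Omega -> T).
Hypothesis mphi : measurable_fun [set: Omega] phi.

Let mphi_mixin := isMeasurableFun.Build _ _ _ _ _ mphi.
Let mphi_pack : {mfun Omega >-> T} := HB.pack phi mphi_mixin.

Definition law : probability T R := distribution P mphi_pack.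

Lemma integral_law (f : T -> \bar R) : measurable_fun [set: T] f ->
  (forall t, 0 <= f t) -> \int[law]_t f t = \int[P]_w f (phi w).
Proof. by move=> mf f0; rewrite ge0_integral_pushforward. Qed.

End law.

Section poisson_process_theory.
Context (R : realType) (d : measure_display) (X : measurableType d).
Context (X0 : set (set X)) (hX0 : localising_ring X0).
Notation N := (point_measure R X0).

Lemma pm_restrE (mu : N) (D B : set X) : measurable D ->
  pm_restr hX0 mu D B = mu (B `&` D).
Proof. by move=> mD; rewrite /pm_restr; case: pselect. Qed.

Lemma measurable_pm_restr (D : set X) : measurable D ->
  measurable_fun [set: N] (fun mu : N => pm_restr hX0 mu D).
Proof.
move=> mD; apply: measurable_pmP => B mB; under eq_fun do rewrite pm_restrE//.
by apply: measurable_pm_ev; exact: measurableI.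
Qed.

Definition pois (r : R) (k : nat) : R := expR (- r) * r ^+ k / k`!%:R.

(** Mecke's equation for the count of a single set. *)
Lemma pois_succ r k : (k.+1%:R * pois r k.+1 = r * pois r k)%R.
Proof.
rewrite /pois factS natrM exprS invfM; field.
by rewrite nat1r !pnatr_eq0 -lt0n fact_gt0.
Qed.

Section one_process.
Context (dO : measure_display) (Omega : measurableType dO).
Context (P : probability Omega R) (eta : Omega -> N) (lam : set X -> \bar R).
Hypothesis heta : poisson_process P eta lam.

Lemma measurable_pp_ev B : measurable B ->
  measurable_fun [set: Omega] (fun w => eta w B).
Proof.
by move=> mB; exact: (measurableT_comp (measurable_pm_ev mB) (pp_measurable heta)).
Qed.

Lemma pp_prob B k : measurable B -> lam B < +oo ->
  P [set w | eta w B = k%:R%:E] = (pois (fine (lam B)) k)%:E.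
Proof.
move=> mB; have := pp_poisson heta mB; case: (lam B) => [r|//|//] [_ +] _.
exact.
Qed.

Lemma pp_fin_num B : measurable B -> lam B < +oo -> lam B \is a fin_num.
Proof. by move=> mB; have := pp_poisson heta mB; case: (lam B). Qed.

(** At rate [+oo] both sides vanish. The case cannot be avoided, since the complement of a hull may
    have infinite intensity. *)
Lemma pp_void B : measurable B ->
  P [set w | eta w B = 0] = expeR (- lam B).
Proof.
move=> mB; have := pp_poisson heta mB; case lE : (lam B) => [r| |//] /=.
  by move=> [_ /(_ 0%N)] ->; rewrite expr0 mulr1 fact0 divr1.
move=> h1; apply/eqP; rewrite eq_le measure_ge0 andbT.
have h0 : P (~` [set w | eta w B = +oo]) = 0.
  rewrite probability_setC ?h1 ?subee//.
  exact: (measurableT_preimage (measurable_pp_ev mB) (emeasurable_set1 +oo)).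
apply: (@le_trans _ _ (P (~` [set w | eta w B = +oo]))); last by rewrite h0.
apply: le_measure; rewrite ?inE.
- exact: (measurableT_preimage (measurable_pp_ev mB) (emeasurable_set1 0)).
- apply: measurableC.
  exact: (measurableT_preimage (measurable_pp_ev mB) (emeasurable_set1 +oo)).
- by move=> w /= ->.
Qed.

Lemma pp_independent_fin (S : finType) (D : S -> set X) (A : S -> set (\bar R)) :
  (forall s, measurable (D s)) -> trivIset [set: S] D ->
  (forall s, measurable (A s)) ->
  P [set w | forall s, A s (eta w (D s))] =
  \prod_s P [set w | A s (eta w (D s))].
Proof.
move=> mD tD mA.
have h := pp_independent heta (B := fun i : 'I_#|S| => D (enum_val i)) (fun i => mD _).
rewrite (_ : [set w | _] = \bigcap_(i : 'I_#|S|)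
    ((fun w => eta w (D (enum_val i))) @^-1` A (enum_val i))); last first.
  apply/seteqP; split => [w /= hw i _|w /= hw s]; first exact: hw.
  by have := hw (enum_rank s) Logic.I; rewrite /= enum_rankK.
rewrite h; last by move=> i.
  rewrite -(big_enum_val (A := S) (fun s => P [set w | A s (eta w (D s))])).
  exact: eq_bigl.
move=> i j _ _ [x [xi xj]]; apply: enum_val_inj.
by apply: tD => //; exists x.
Qed.

Lemma pp_box (S : finType) (D : S -> set X) (l : S -> nat) :
  (forall s, measurable (D s)) -> (forall s, lam (D s) < +oo) ->
  trivIset [set: S] D ->
  P (eta @^-1` pm_box D l) = (\prod_s pois (fine (lam (D s))) (l s))%:E.
Proof.
move=> mD lD tD.
rewrite (pp_independent_fin (A := fun s => [set (l s)%:R%:E])) // -prodEFin.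
by apply: eq_bigr => s _; rewrite -pp_prob.
Qed.

(** Allows passing to the canonical process: expectations of functions of [eta] become integrals
    over N. *)
Lemma pp_law : poisson_process (law P (pp_measurable heta)) id lam.
Proof.
split=> //.
- by move=> B mB; exact: (pp_poisson heta mB).
- move=> B mB; rewrite (integral_law P (pp_measurable heta) (measurable_pm_ev mB))//.
  exact: (pp_intensity heta).
- by move=> m B mB tB A mA; exact: (pp_independent heta).
Qed.

Section restriction.
Context (D : set X) (mD : measurable D).

Lemma pp_restr :
  poisson_process P (fun w => pm_restr hX0 (eta w) D) (restriction lam D).
Proof.
have E B : (fun w => pm_restr hX0 (eta w) D B) = (fun w => eta w (B `&` D)).
  by apply/funext => w; rewrite pm_restrE.
split.
- exact: (measurableT_comp (measurable_pm_restr mD) (pp_measurable heta)).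
- by move=> B mB; rewrite E; apply: (pp_poisson heta); exact: measurableI.
- by move=> B mB; rewrite E; apply: (pp_intensity heta); exact: measurableI.
- move=> m B mB tB.
  rewrite (_ : (fun i w => _) = (fun i w => eta w (B i `&` D))).
    apply: (pp_independent heta) => [i|]; first exact: measurableI.
    exact: trivIset_setIr.
  by apply/funext => i; rewrite E.
Qed.

End restriction.
End one_process.

Lemma pp_unique (dO dO' : measure_display) (Omega : measurableType dO)
    (Omega' : measurableType dO') (P : probability Omega R)
    (P' : probability Omega' R) (eta : Omega -> N) (eta' : Omega' -> N)
    (lam : set X -> \bar R) : (forall B, X0 B -> lam B < +oo) ->
  poisson_process P eta lam -> poisson_process P' eta' lam ->
  forall A, measurable A -> P (eta @^-1` A) = P' (eta' @^-1` A).
Proof.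
move=> lfin heta heta'.
apply: (@pm_measure_unique _ _ _ _ hX0 (law P (pp_measurable heta))
  (law P' (pp_measurable heta')) set0 (lring0 hX0)).
  exact: (le_lt_trans (probability_le1 _ measurableT) (ltry 1)).
move=> S D l XD tD _.
have mD s : measurable (D s) by exact/(lring_measurable hX0).
by rewrite [LHS](pp_box heta)// ?[RHS](pp_box heta')// => s; exact: lfin.
Qed.

End poisson_process_theory.

(** * Independence of a void event and the process on the complement *)

Section void_independence.
Context (R : realType) (d : measure_display) (X : measurableType d).
Context (X0 : set (set X)) (hX0 : localising_ring X0).
Notation N := (point_measure R X0).
Context (dO : measure_display) (Omega : measurableType dO).
Context (P : probability Omega R) (eta : Omega -> N) (lam : set X -> \bar R).
Hypothesis heta : poisson_process P eta lam.
Context (D : set X) (mD : measurable D).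

(** Both sides are finite measures in [A], so boxes suffice. There the complement of [D] is one more
    cell, disjoint from the sets [C s] cut by [D], and independence of increments factors the
    probability. *)
Lemma pp_void_restr A : measurable A ->
  P [set w | eta w (~` D) = 0 /\ A (pm_restr hX0 (eta w) D)] =
  P [set w | eta w (~` D) = 0] * P [set w | A (pm_restr hX0 (eta w) D)].
Proof.
have mrs : measurable_fun [set: Omega] (fun w => pm_restr hX0 (eta w) D).
  exact: (measurableT_comp (measurable_pm_restr hX0 mD) (pp_measurable heta)).
pose V := [set w | eta w (~` D) = 0].
have mV : measurable V.
  apply: (measurableT_preimage (measurable_pp_ev heta _) (emeasurable_set1 0)).
  exact: measurableC.
pose p : {nonneg R} := NngNum (fine_ge0 (measure_ge0 P V)).
pose M := push (mrestr P mV) mrs; pose M' := mscale p (push P mrs).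
suff : forall A, measurable A -> M A = M' A.
  move=> + mA => /(_ A mA); rewrite /M /M'/= /pushforward /mrestr /mscale/=.
  by rewrite fineK ?fin_num_measure// setIC.
apply: (@pm_measure_unique _ _ _ _ hX0 M M' set0 (lring0 hX0)).
  rewrite /M /= /pushforward /mrestr preimage_setT setTI.
  exact: (le_lt_trans (probability_le1 _ mV) (ltry 1)).
move=> S C l XC tC _; rewrite /M /M' /= /pushforward /mrestr /mscale/=.
rewrite fineK ?fin_num_measure//.
have mC s : measurable (C s) by exact/(lring_measurable hX0).
have mCD s : measurable (C s `&` D) by exact: measurableI.
have boxE : (fun w => pm_restr hX0 (eta w) D) @^-1` pm_box C l =
    [set w | forall s, [set (l s)%:R%:E] (eta w (C s `&` D))].
  by apply/seteqP; split => w h s; have := h s; rewrite /= pm_restrE.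
pose E (z : unit + S) := if z is inr s then C s `&` D else ~` D.
pose B (z : unit + S) : set (\bar R) :=
  if z is inr s then [set (l s)%:R%:E] else [set 0].
have tCD : trivIset [set: S] (fun s => C s `&` D) by exact: trivIset_setIr.
rewrite boxE (_ : _ `&` V = [set w | forall z, B z (eta w (E z))]); last first.
  apply/seteqP; split => [w [h v] [z|s]|w h]; [exact: v|exact: h|].
  by split=> [s|]; [exact: (h (inr s))|exact: (h (inl tt))].
rewrite (pp_independent_fin heta)//.
- rewrite big_sumType/= (big_pred1 tt)//=.
  rewrite /pushforward boxE.
  by rewrite (pp_independent_fin heta (A := fun s => [set (l s)%:R%:E])).
- by case=> [z|s]; [exact: measurableC|exact: mCD].
- move=> [[]|s] [[]|t] _ _ [x []] //=; first by move=> h [].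
    by move=> [].
  by move=> h h'; congr inr; apply: tC => //; exists x; split; case: h; case: h'.
- by case=> [z|s] /=; exact: emeasurable_set1.
Qed.

Lemma pp_void_integral (f : N -> \bar R) : measurable_fun [set: N] f ->
  (forall mu, 0 <= f mu) ->
  \int[P]_w ((\1_[set w | eta w (~` D) = 0%E] w)%:E * f (pm_restr hX0 (eta w) D)) =
  expeR (- lam (~` D)) * \int[P]_w f (pm_restr hX0 (eta w) D).
Proof.
move=> mf f0; pose rs w := pm_restr hX0 (eta w) D.
have mrs : measurable_fun [set: Omega] rs.
  exact: (measurableT_comp (measurable_pm_restr hX0 mD) (pp_measurable heta)).
pose V := [set w | eta w (~` D) = 0].
have mV : measurable V.
  apply: (measurableT_preimage (measurable_pp_ev heta _) (emeasurable_set1 0)).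
  exact: measurableC.
have r0 w : (0 <= \1_V w :> R)%R by rewrite indicE.
pose r w : {nonneg R} := NngNum (r0 w).
(* Averaging these weighted Dirac masses turns the left side into the integral of [f] against one
   measure on N, to be compared with a multiple of the law of the restriction. *)
pose k w : {measure set N -> \bar R} := mscale (r w) (dirac (rs w)).
have mk U : measurable U -> measurable_fun [set: Omega] (k ^~ U).
  move=> mU; apply: emeasurable_funM.
    exact/measurable_EFinP/measurable_indic.
  have mI : measurable_fun [set: N] (\1_U : N -> R) by exact: measurable_indic.
  by apply/measurable_EFinP; exact: (measurableT_comp mI mrs).
pose p : {nonneg R} := NngNum (fine_ge0 (measure_ge0 P V)).
transitivity (\int[mixture_measure P mk]_mu f mu).
  rewrite [RHS](integral_mixture _ mk)//; apply: eq_integral => w _.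
  by rewrite ge0_integral_mscale//= integral_dirac// diracT mul1e.
transitivity (\int[mscale p (push P mrs)]_mu f mu).
  apply: eq_measure_integral => U mU _.
  rewrite [LHS](_ : _ = \int[P]_w (\1_(V `&` rs @^-1` U) w)%:E); last first.
    apply: eq_integral => w _; rewrite /k /= /mscale/= /dirac -EFinM !indicE in_setI.
    by rewrite -natrM mulnb; congr (_ && _)%:R%:E; apply/idP/idP; rewrite !inE.
  have mU' : measurable (rs @^-1` U) by exact: measurableT_preimage mrs mU.
  rewrite integral_indic ?setIT//; last exact: measurableI.
  rewrite [LHS](pp_void_restr mU).
  transitivity ((fine (P V))%:E * P (rs @^-1` U)); last by [].
  by rewrite fineK// fin_num_measure.
rewrite ge0_integral_mscale// -(pp_void heta); last exact: measurableC.
rewrite [X in _ * X](ge0_integral_pushforward mrs P measurableT mf)// preimage_setT.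
by rewrite /= fineK// fin_num_measure.
Qed.

End void_independence.

(** * Mecke's equation *)

Section mecke.
Context (R : realType) (d : measure_display) (X : measurableType d).
Context (X0 : set (set X)) (hX0 : localising_ring X0).
Notation N := (point_measure R X0).
Context (Q : probability N R) (lam : {measure set X -> \bar R}).
Hypothesis lfin : locally_finite X0 lam.
Hypothesis hQ : poisson_process Q (@id N) lam.

Let mpair mu : measurable_fun [set: X] (fun x : X => (mu, x) : N * X).
Proof. by apply: measurable_fun_pair. Qed.

Let shift x (mu : N) : N * X := (pm_add mu (pm_dirac R X0 x), x).

Let mshift2 : measurable_fun [set: N * X] (fun p => shift p.2 p.1).
Proof. by apply: measurable_fun_pair => //; exact: (@measurable_add_dirac R d X X0). Qed.

Let mshift x : measurable_fun [set: N] (shift x).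
Proof.
have -> : shift x = (fun p : N * X => shift p.2 p.1) \o (fun mu => (mu, x)) by [].
by apply: measurableT_comp => //; exact: measurable_fun_pair.
Qed.

Let k1 (mu : N) := push mu (mpair mu).
Let k2 (x : X) := push Q (mshift x).

Let mk1 U : measurable U -> measurable_fun [set: N] (k1 ^~ U).
Proof.
move=> mU; rewrite (_ : k1 ^~ U = fun mu => mu (xsection U mu)).
  by apply: measurable_pm_xsection.
apply/funext => mu; rewrite /k1/= /pushforward; congr (mu _).
by apply/seteqP; split => x; rewrite /xsection/= inE.
Qed.

Let mk2 U : measurable U -> measurable_fun [set: X] (k2 ^~ U).
Proof.
move=> mU.
have mV := measurableT_preimage mshift2 mU.
rewrite (_ : k2 ^~ U = Q \o ysection ((fun p : N * X => shift p.2 p.1) @^-1` U)).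
  exact: measurable_fun_ysection.
apply/funext => x; rewrite /k2/= /pushforward; congr (Q _).
by apply/seteqP; split => mu; rewrite /ysection/= inE.
Qed.

(** [M1] is the Campbell measure of the process and [M2] the measure behind the right side of
    Mecke's equation, which thus says that the two coincide. *)
Let M1 := mixture_measure Q mk1.
Let M2 := mixture_measure lam mk2.

(** With [B] fixed, both sides are finite measures in [A], so boxes over disjoint cells suffice,
    some of which make up [B]. On such a box [mu B] is a fixed sum of counts, while adding a point
    in the cell [D s] lowers by one the count required of that cell beforehand. *)
Let M12_rect A B : measurable A -> X0 B -> M1 (A `*` B) = M2 (A `*` B).
Proof.
move=> + XB; have mB : measurable B by exact/(lring_measurable hX0).
have mE : measurable ([set: N] `*` B) by exact: measurableX.
pose M := push (mrestr M1 mE) measurable_fst.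
pose M' := push (mrestr M2 mE) measurable_fst.
have AB (U : set N) : fst @^-1` U `&` [set: N] `*` B = U `*` B.
  by apply/seteqP; split => [[mu x] [? []]|[mu x] []].
suff : forall A, measurable A -> M A = M' A.
  by move=> + mA => /(_ A mA); rewrite /M /M'/= /pushforward /mrestr AB.
have ME U : M U = \int[Q]_mu ((\1_U mu)%:E * mu B).
  rewrite /M/= /pushforward /mrestr AB; apply: eq_integral => mu _.
  rewrite /k1/= /pushforward indicE; have [muU|muU] := boolP (mu \in U).
    rewrite mul1e; congr (mu _); apply/seteqP; split => [x []//|x Bx].
    by split => //; rewrite inE in muU.
  rewrite mul0e (_ : _ @^-1` _ = set0) ?measure0//; apply/seteqP; split => // x [/=].
  by move=> h; move: muU; rewrite mem_set.
apply: (@pm_measure_unique _ _ _ _ hX0 M M' B XB).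
  rewrite ME; under eq_integral do rewrite indicT mul1e.
  by rewrite (pp_intensity hQ mB) lfin.
move=> S D l XD tD [J BE].
have mD s : measurable (D s) by exact/(lring_measurable hX0).
have lD s : lam (D s) < +oo by exact: lfin.
have mbox l' : measurable (pm_box (X0 := X0) (R := R) D l') by exact: measurable_pm_box.
transitivity (\sum_(s <- enum J) ((l s)%:R%:E * Q (pm_box D l))).
  rewrite ME -ge0_sume_distrl; last by move=> s _; rewrite lee_fin.
  rewrite sumEFin -natr_sum.
  transitivity (\int[Q]_mu ((\1_(pm_box D l) mu)%:E * (\sum_(s <- enum J) l s)%N%:R%:E)).
    apply: eq_integral => mu _; rewrite indicE.
    have [|_] := boolP (mu \in _); last by rewrite !mul0e.
    rewrite inE => h; congr (_ * _); rewrite [in LHS]BE measure_fin_disjoint//.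
    rewrite (eq_bigr (fun s => (l s)%:R%:E)) => [|s _]; last exact: h.
    by rewrite sumEFin -natr_sum big_enum.
  rewrite ge0_integralZr//; last exact/measurable_EFinP/measurable_indic.
  by rewrite integral_indic// setIT muleC.
pose l' s t := (l t - (t == s))%N.
(* A configuration with an added point in [D s] never meets the requirement of 0 points there.
   Truncated subtraction would hide this, hence the separate case. *)
pose c s : \bar R := if l s is 0%N then 0 else Q (pm_box D (l' s)).
(* In the product formula for the box only the factor of the cell [s] changes, by the Poisson
   recursion. *)
transitivity (\sum_(s <- enum J) (lam (D s) * c s)).
  apply: eq_bigr => s _; rewrite /c.
  have box0 m : Q (pm_box D m) = (\prod_t pois (fine (lam (D t))) (m t))%:E.
    by rewrite -(pp_box hQ m mD lD tD).
  case lsE : (l s) => [|k]; first by rewrite mul0e mule0.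
  rewrite !box0 (bigD1 s)//= [in RHS](bigD1 s)//= lsE.
  rewrite -[X in _ = X * _]fineK; last exact: (pp_fin_num hQ).
  rewrite -!EFinM mulrA pois_succ -mulrA /l' eqxx lsE subn1/=.
  congr (_ * (_ * _))%:E.
  by apply: eq_bigr => t /negbTE ->; rewrite subn0.
rewrite /M'/= /pushforward /mrestr AB.
transitivity (\int[lam]_x (\sum_(s <- enum J) ((\1_(D s) x)%:E * c s))).
  have c0 s : 0 <= c s by rewrite /c; case: (l s).
  rewrite ge0_integral_sum//.
  - apply: eq_bigr => s _; rewrite ge0_integralZr//.
      by rewrite integral_indic// setIT.
    exact/measurable_EFinP/measurable_indic.
  - move=> s; apply: emeasurable_funM; last exact: measurable_cst.
    exact/measurable_EFinP/measurable_indic.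
  - by move=> s x _; rewrite mule_ge0// lee_fin.
apply: eq_integral => x _; rewrite /k2/= /pushforward.
have [Bx|Bx] := pselect (B x); last first.
  rewrite (_ : shift x @^-1` _ = set0) ?measure0.
    rewrite big_enum big1// => s Js; rewrite indicE memNset ?mul0e//.
    by move=> Dx; apply: Bx; rewrite BE; exists s.
  by apply/seteqP; split => // mu [].
have [s Js Dx] : exists2 s, J s & D s x by move: Bx; rewrite BE.
have DxE t : (x \in D t) = (t == s).
  apply/idP/eqP => [|->]; last by rewrite mem_set.
  by rewrite inE => Dtx; apply: tD => //; exists x.
rewrite big_enum (bigD1 s)//= big1 => [|t /andP[_ ts]]; last first.
  by rewrite indicE DxE (negbTE ts) mul0e.
rewrite adde0 indicE DxE eqxx mul1e.
have shE mu : (shift x @^-1` (pm_box D l `*` B)) mu <->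
    (forall t, mu (D t) + ((t == s)%:R)%:E = (l t)%:R%:E).
  split=> [[h _] t|h]; first by rewrite -(h t) [RHS]pm_addE /= diracE DxE.
  by split => // t; rewrite [LHS]pm_addE /= diracE DxE; exact: h.
rewrite /c; case lsE : (l s) => [|k].
  rewrite (_ : shift x @^-1` _ = set0) ?measure0//; apply/seteqP; split => // mu.
  move=> /(proj1 (shE mu)) h; have := h s; have [j ->] := pm_nat mu (XD s).
  by rewrite eqxx lsE -EFinD -natrD => /EFin_natI; rewrite addn1.
congr (Q _); apply/esym/seteqP; split => mu.
  move=> /(proj1 (shE mu)) h t; have := h t; have [j ->] := pm_nat mu (XD t).
  by rewrite -EFinD -natrD => /EFin_natI e; rewrite /l' -e addnK.
move=> h; apply: (proj2 (shE mu)) => t; rewrite h -EFinD -natrD /l' subnK//.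
by have [->|//] := eqVneq t s; rewrite lsE.
Qed.

Let M12 U : measurable U -> M1 U = M2 U.
Proof.
have [Bn [nd X0B mBn UB]] := lring_cover hX0.
pose G : set (set (N * X)) := [set U | exists A B, [/\ measurable A, X0 B & U = A `*` B]].
apply: (measure_unique G (fun n => setT `*` Bn n)).
- rewrite measurable_prod_measurableType; apply/seteqP; split.
    apply: smallest_sub; first exact: smallest_sigma_algebra.
    move=> _ [A mA [B mB <-]].
    rewrite -[B]setIT -UB setI_bigcupr setX_bigcupr.
    apply: (@bigcupT_measurable _ (g_sigma_algebraType G)) => n.
    apply: sub_sigma_algebra; exists A, (B `&` Bn n); split => //.
    by rewrite setIC; exact: (lring_setI hX0).
  apply: smallest_sub; first exact: smallest_sigma_algebra.
  move=> _ [A [B [mA XB ->]]]; apply: sub_sigma_algebra; exists A => //.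
  by exists B => //; exact/(lring_measurable hX0).
- move=> _ _ [A [B [mA XB ->]]] [A' [B' [mA' XB' ->]]].
  exists (A `&` A'), (B `&` B'); rewrite setXI; split => //; first exact: measurableI.
  by apply: (lring_setI hX0) => //; exact/(lring_measurable hX0).
- by move=> n; exists setT, (Bn n).
- apply/seteqP; split => // -[mu x] _; have [n _ Bx] : (\bigcup_n Bn n) x by rewrite UB.
  by exists n.
- by move=> _ [A [B [mA XB ->]]]; exact: M12_rect.
- move=> n; rewrite (_ : M1 _ = \int[Q]_mu mu (Bn n)).
    by rewrite (pp_intensity hQ)// lfin.
  apply: eq_integral => mu _; rewrite /k1/= /pushforward; congr (mu _).
  by apply/seteqP; split => [x []//|x].
Qed.

Lemma mecke (f : N * X -> \bar R) : (forall z, 0 <= f z) ->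
  measurable_fun [set: N * X] f ->
  \int[Q]_mu \int[mu]_x f (mu, x) =
  \int[lam]_x \int[Q]_mu f (pm_add mu (pm_dirac R X0 x), x).
Proof.
move=> f0 mf; transitivity (\int[M1]_z f z).
  rewrite [RHS](integral_mixture _ mk1)//; apply: eq_integral => mu _.
  by rewrite [RHS](ge0_integral_pushforward (mpair mu)).
transitivity (\int[M2]_z f z).
  by apply: eq_measure_integral => U mU _; exact: M12.
rewrite [LHS](integral_mixture _ mk2)//; apply: eq_integral => x _.
by rewrite [LHS](ge0_integral_pushforward (mshift x)).
Qed.

End mecke.

(** * Product measures on tuples *)

Section tuples.
Context (R : realType) (d : measure_display) (X : measurableType d).
Context (X0 : set (set X)) (hX0 : localising_ring X0).
Notation N := (point_measure R X0).

Lemma pm_tuple_cons n (x : n.-tuple X) y :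
  pm_tuple R X0 [tuple of y :: x] =
  pm_add (pm_dirac R X0 y) (pm_tuple R X0 x).
Proof.
rewrite /pm_tuple big_ord_recl tnth0; congr pm_add.
by apply: eq_bigr => i _; rewrite tnthS.
Qed.

Lemma pm_tupleE n (x : n.-tuple X) B :
  pm_tuple R X0 x B = \sum_(i < n) \d_(tnth x i) B.
Proof.
rewrite /pm_tuple (big_morph (fun mu : N => mu B) (id1 := 0) (op1 := +%E))//.
by move=> mu nu; exact: pm_addE.
Qed.

Lemma measurable_pm_tuple n : measurable_fun [set: n.-tuple X] (@pm_tuple R d X X0 n).
Proof.
apply: measurable_pmP => B mB; under eq_fun do rewrite pm_tupleE.
apply: emeasurable_sum => i; apply/measurable_EFinP.
rewrite (_ : (fun x => _) = (\1_B : X -> R) \o (@tnth n X ^~ i))//.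
by apply: measurableT_comp; [exact: measurable_indic|exact: measurable_tnth].
Qed.

Lemma pm_tupleT n (x : n.-tuple X) : pm_tuple R X0 x setT = n%:R%:E.
Proof.
rewrite pm_tupleE (eq_bigr (fun=> 1)) => [|i _]; last by rewrite diracT.
by rewrite sumEFin sumr_const card_ord.
Qed.

Context (lam : {measure set X -> \bar R}) (lfin : locally_finite X0 lam).

Lemma lring_sigma_finite : sigma_finite [set: X] lam.
Proof.
have [Bn [nd X0B mBn UB]] := lring_cover hX0.
by exists Bn => // n; split => //; exact: lfin.
Qed.

Let lamf : set X -> \bar R := lam.
HB.instance Definition _ := Measure.on lamf.
HB.instance Definition _ :=
  Measure_isSigmaFinite.Build _ _ _ lamf lring_sigma_finite.
Definition lring_lam : {sigma_finite_measure set X -> \bar R} := lamf.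

Let tcons n (p : n.-tuple X * X) : n.+1.-tuple X := [tuple of p.2 :: p.1].

Lemma measurable_tcons n : measurable_fun [set: n.-tuple X * X] (@tcons n).
Proof. exact: measurable_cons measurable_snd measurable_fst. Qed.

Section power_step.
Context (n : nat) (m : {sigma_finite_measure set (n.-tuple X) -> \bar R}).

Definition power_step : set (n.+1.-tuple X) -> \bar R :=
  push (m \x lring_lam) (@measurable_tcons n).
HB.instance Definition _ := Measure.on power_step.

Let power_step_sigma_finite : sigma_finite [set: n.+1.-tuple X] power_step.
Proof.
have /sigma_finiteP[F [UF ndF Ffin]] := sigma_finiteT m.
have /sigma_finiteP[G [UG ndG Gfin]] := sigma_finiteT lring_lam.
pose h (z : n.+1.-tuple X) : n.-tuple X * X := ([tuple of behead z], thead z).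
have mh : measurable_fun [set: n.+1.-tuple X] h.
  by apply: measurable_fun_pair; [exact: measurable_behead|exact: measurable_tnth].
have hK p : h (tcons p) = p.
  by case: p => x y; congr pair; apply: val_inj.
exists (fun k => h @^-1` (F k `*` G k)).
  apply/seteqP; split => // z _.
  have [i _ Fi] : (\bigcup_i F i) (h z).1 by rewrite -UF.
  have [j _ Gj] : (\bigcup_i G i) (h z).2 by rewrite -UG.
  exists (maxn i j) => //; split.
    by move: Fi; exact/subsetPset/ndF/leq_maxl.
  by move: Gj; exact/subsetPset/ndG/leq_maxr.
move=> k; have [mF Fk] := Ffin k; have [mG Gk] := Gfin k.
split; first by apply: (measurableT_preimage mh); exact: measurableX.
rewrite /power_step/= /pushforward.
rewrite (_ : tcons (n := n) @^-1` _ = F k `*` G k); last first.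
  rewrite -comp_preimage (_ : h \o tcons (n := n) = id) ?preimage_id//.
  by apply/funext => p; exact: hK.
by rewrite product_measure1E// lte_mul_pinfty// ge0_fin_numE.
Qed.

HB.instance Definition _ :=
  Measure_isSigmaFinite.Build _ _ _ power_step power_step_sigma_finite.
Definition power_step_sf : {sigma_finite_measure set (n.+1.-tuple X) -> \bar R} :=
  power_step.

End power_step.

(** [power_measure] is a bare set function; this equips it with the sigma-finite structure that
    Tonelli's theorem requires. *)
Lemma power_measure_sigma_finite n :
  exists m : {sigma_finite_measure set (n.-tuple X) -> \bar R},
    (m : set _ -> \bar R) = power_measure lam n.
Proof.
elim: n => [|n [m mE]]; first by exists (\d_[tuple]).
by exists (power_step_sf m); rewrite /= -mE.
Qed.

Lemma integral_power_measure0 (f : 0.-tuple X -> \bar R) :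
  measurable_fun [set: 0.-tuple X] f -> \int[power_measure lam 0]_x f x = f [tuple].
Proof. by move=> mf; rewrite /= integral_dirac// diracT mul1e. Qed.

Lemma integral_power_measureS n (f : n.+1.-tuple X -> \bar R) :
  measurable_fun [set: n.+1.-tuple X] f -> (forall z, 0 <= f z) ->
  \int[power_measure lam n.+1]_z f z =
  \int[power_measure lam n]_x \int[lam]_y f [tuple of y :: x].
Proof.
move=> mf f0; have [m mE] := power_measure_sigma_finite n.
rewrite /= -mE; transitivity (\int[m \x lring_lam]_p f (tcons p)).
  by rewrite -[RHS](ge0_integral_pushforward (@measurable_tcons n) (m \x lring_lam)
    measurableT mf).
rewrite (@fubini_tonelli1 _ _ _ _ _ m lring_lam)//.
exact: measurableT_comp mf (@measurable_tcons n).
Qed.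

End tuples.

(** * The joint law of the selection and its hull *)

Section stopping_formula.
Context (R : realType) (d : measure_display) (X : measurableType d).
Context (hX : borel_space R X) (X0 : set (set X)) (hX0 : localising_ring X0).
Notation N := (point_measure R X0).
Context (del : N -> N) (hdel : generator del).
Notation h mu := (hull del mu).
Notation tup x := (pm_tuple R X0 x).

Section measurability.
Context (dT : measure_display) (T : measurableType dT) (f g : T -> N).
Hypotheses (mf : measurable_fun [set: T] f) (mg : measurable_fun [set: T] g).

Let measurable_E : measurable [set p : T * X | h (g p.1) p.2].
Proof.
have mgg : measurable_fun [set: T * X] (fun p => (g p.1, p.2)).
  by apply: measurable_fun_pair => //; exact: (measurableT_comp mg measurable_fst).
exact: (measurableT_preimage mgg (measurable_hull_pair hX hX0 hdel)).
Qed.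

Let xsection_E t : xsection [set p : T * X | h (g p.1) p.2] t = h (g t).
Proof. by apply/seteqP; split => x; rewrite /xsection/= inE. Qed.

Let xsection_EC t : xsection (~` [set p : T * X | h (g p.1) p.2]) t = ~` h (g t).
Proof. by apply/seteqP; split => x; rewrite /xsection/= inE. Qed.

Lemma measurable_hull_mass : measurable_fun [set: T] (fun t => f t (h (g t))).
Proof.
have := measurable_pm_xsection hX0 mf measurable_E.
by under eq_fun do rewrite xsection_E.
Qed.

Lemma measurable_hullC_mass : measurable_fun [set: T] (fun t => f t (~` h (g t))).
Proof.
have := measurable_pm_xsection hX0 mf (measurableC measurable_E).
by under eq_fun do rewrite xsection_EC.
Qed.

Lemma measurable_hull_restr :
  measurable_fun [set: T] (fun t => pm_restr hX0 (f t) (h (g t))).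
Proof.
apply: measurable_pmP => B mB.
rewrite (_ : (fun t => _) = (fun t => f t (B `&` h (g t)))); last first.
  by apply/funext => t; rewrite pm_restrE//; exact: measurable_hull.
have mEB : measurable ([set p : T * X | h (g p.1) p.2] `&` snd @^-1` B).
  by apply: measurableI => //; exact: measurableT_preimage measurable_snd mB.
have := measurable_pm_xsection hX0 mf mEB.
rewrite (_ : (fun s => _) = (fun t => f t (B `&` h (g t))))//.
apply/funext => t; congr (f t _); rewrite setIC.
by apply/seteqP; split => x; rewrite /xsection/= inE.
Qed.

End measurability.

Lemma measurable_C_ n : measurable (C_ del n).
Proof.
have mt := @measurable_pm_tuple R d X X0 n.
have mp : measurable_fun [set: n.-tuple X] (fun x : n.-tuple X => (del (tup x), tup x)).
  by apply: measurable_fun_pair => //; exact: (measurableT_comp (gen_measurable hdel) mt).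
exact: (measurableT_preimage mp (measurable_pm_eq hX hX0)).
Qed.

Context (Q : probability N R) (lam : {measure set X -> \bar R}).
Hypothesis lfin : locally_finite X0 lam.
Hypothesis hQ : poisson_process Q (@id N) lam.
(** The void probability presents the exponential as the [Q]-measure of a section of a measurable
    set, so measurability of sections applies, infinite intensities included. *)
Lemma measurable_exp_hullC (dT : measure_display) (T : measurableType dT)
    (g : T -> N) : measurable_fun [set: T] g ->
  measurable_fun [set: T] (fun t => expeR (- lam (~` h (g t)))).
Proof.
move=> mg.
have m1 := measurable_hullC_mass (@measurable_snd _ _ T N)
  (measurableT_comp mg (@measurable_fst _ _ T N)).
have := measurable_fun_xsection Q (measurableT_preimage m1 (emeasurable_set1 0)).
rewrite (_ : (_ \o _) = (fun t => expeR (- lam (~` h (g t)))))//.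
apply/funext => t /=; rewrite -(pp_void hQ); last first.
  by apply: measurableC; exact: measurable_hull.
by congr (Q _); apply/seteqP; split => mu; rewrite /xsection/= inE.
Qed.

Context (F : N * N -> \bar R).
Hypotheses (mF : measurable_fun [set: N * N] F) (F0 : forall p, 0 <= F p).

Lemma measurable_pm_eq2 (mu mu' nu nu' : N) :
  mu ≡μ mu' -> nu ≡μ nu' -> F (mu, nu) = F (mu', nu').
Proof.
move=> e e'.
have m1 : measurable_fun [set: N] (fun a => F (a, nu)).
  by apply: measurableT_comp => //; exact: measurable_fun_pair.
have m2 : measurable_fun [set: N] (fun b => F (mu', b)).
  by apply: measurableT_comp => //; exact: measurable_fun_pair.
by rewrite (measurable_ereal_pm_eq m1 e) (measurable_ereal_pm_eq m2 e').
Qed.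

Let S n : set N := [set mu | del mu setT = n%:R%:E].

Lemma measurable_del_size n : measurable (S n).
Proof.
have m1 := measurableT_comp (measurable_pm_ev measurableT) (gen_measurable hdel).
exact: (measurableT_preimage m1 (emeasurable_set1 _)).
Qed.

Let G n mu := (\1_(S n) mu)%:E * F (del mu, pm_restr hX0 mu (h mu)).

Let measurable_G n : measurable_fun [set: N] (G n).
Proof.
apply: emeasurable_funM.
  by apply/measurable_EFinP/measurable_indic; exact: measurable_del_size.
apply: measurableT_comp => //; apply: measurable_fun_pair.
  exact: gen_measurable.
exact: measurable_hull_restr.
Qed.

Let G0 n mu : 0 <= G n mu.
Proof. by rewrite mule_ge0// lee_fin. Qed.

(** By [delE] this is the event that all [k] points of the tuple are selected from the total
    configuration. *)
Let V k : set (k.-tuple X * N) :=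
  [set p | tup p.1 (h (pm_add (tup p.1) p.2)) = 0].

Let msum k : measurable_fun [set: k.-tuple X * N] (fun p => pm_add (tup p.1) p.2).
Proof.
apply: measurable_pm_add => //.
exact: (measurableT_comp (@measurable_pm_tuple R d X X0 k) measurable_fst).
Qed.

Let measurable_V k : measurable (@V k).
Proof.
have mt := measurableT_comp (@measurable_pm_tuple R d X X0 k)
  (@measurable_fst _ _ (k.-tuple X) N).
exact: (measurableT_preimage (measurable_hull_mass mt (@msum k)) (emeasurable_set1 0)).
Qed.

(* [H n k] carries the first [k] selected points in its tuple argument;
   integrating one more of them out of [mu] by Mecke's equation turns
   [H n k] into [H n k.+1]. *)
Let H n k (p : k.-tuple X * N) : \bar R :=
  (\1_(@V k) p)%:E * G n (pm_add (tup p.1) p.2).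

Let measurable_H n k : measurable_fun [set: k.-tuple X * N] (@H n k).
Proof.
apply: emeasurable_funM.
  by apply/measurable_EFinP/measurable_indic; exact: measurable_V.
exact: measurableT_comp (measurable_G n) (@msum k).
Qed.

Let H0 n k p : 0 <= @H n k p.
Proof. by rewrite mule_ge0 ?G0// lee_fin. Qed.

(** Where [H] does not vanish, the total configuration has [n] points outside its hull and the tuple
    accounts for [k] of them, so [nu] has the other n - k. This count is the factor gained at each
    use of Mecke's equation. *)
Let H_mass n k (x : k.-tuple X) (nu : N) : (k <= n)%N ->
  @H n k (x, nu) * nu (~` h (pm_add (tup x) nu)) = (n - k)%:R%:E * @H n k (x, nu).
Proof.
move=> kn; rewrite /H /G; set mu := pm_add (tup x) nu.
have mh := measurable_hull hX hX0 hdel mu.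
have [|/negbTE xV] := boolP ((x, nu) \in @V k); last by rewrite indicE xV !mul0e mule0.
rewrite inE => v; have [|] := boolP (mu \in S n); last first.
  by move=> /negbTE mS; rewrite [\1_(S n) _]indicE mS !(mul0e, mule0).
rewrite inE => s; rewrite [RHS]muleC; congr (_ * _).
have xC : tup x (~` h mu) = k%:R%:E.
  by rewrite -(pm_tupleT R X0 x) (pm_DI (tup x) measurableT mh) setTI v adde0 setTD.
have : mu (~` h mu) = n%:R%:E by rewrite -setTD -(delE hX hX0 hdel)// s.
rewrite pm_addE xC.
have -> : n%:R%:E = k%:R%:E + (n - k)%:R%:E :> \bar R.
  by rewrite -EFinD -natrD subnKC.
by move=> /(congr1 (fun z => z - k%:R%:E)); rewrite !(addeC k%:R%:E) !addeK.
Qed.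

Let A n k := \int[power_measure lam k]_x \int[Q]_mu @H n k (x, mu).

Let measurable_intH n k :
  measurable_fun [set: k.-tuple X] (fun x => \int[Q]_mu @H n k (x, mu)).
Proof.
exact: (@measurable_fun_fubini_tonelli_F _ _ _ _ _ Q (@H n k)
  (@measurable_H n k) (@H0 n k)).
Qed.

Let A0E n : A n 0 = \int[Q]_mu G n mu.
Proof.
rewrite /A integral_power_measure0; last exact: measurable_intH.
apply: eq_integral => mu _; rewrite /H /=.
have t0 (B : set X) : tup [tuple] B = 0 by rewrite pm_tupleE big_ord0.
rewrite indicE mem_set ?mul1e /V //=.
by apply: measurable_ereal_pm_eq => // B mB; rewrite pm_addE t0 add0e.
Qed.

(** Moving [y] from the configuration to the tuple leaves their sum unchanged. Only the requirement
    that tuple points be selected grows, by the condition that [y] avoids the hull. *)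
Let H_cons n k (x : k.-tuple X) y mu :
  @H n k.+1 ([tuple of y :: x], mu) =
  (\1_(~` h (pm_add (tup x) (pm_add mu (pm_dirac R X0 y)))) y)%:E *
  @H n k (x, pm_add mu (pm_dirac R X0 y)).
Proof.
rewrite /H /=; set nu := pm_add (tup x) _.
have e : pm_add (tup [tuple of y :: x]) mu ≡μ nu.
  move=> B mB; rewrite pm_tuple_cons /nu !pm_addE -addeA addeC -addeA.
  by congr (_ + _); rewrite addeC.
rewrite (measurable_ereal_pm_eq (@measurable_G n) e).
move: (G n nu) => c; rewrite muleA; congr (_ * _).
rewrite -EFinM; congr _%:E; rewrite !indicE -natrM mulnb; congr (_%:R).
apply: congr1; apply/idP/andP;
  rewrite !inE /V/= (hull_eq hdel e) -/nu pm_tuple_cons pm_addE.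
  move=> /eqP; rewrite padde_eq0 ?measure_ge0// => /andP[/eqP dy /eqP dx].
  by split=> // hy; move: dy; rewrite /= diracE mem_set//= => /eqP; rewrite onee_eq0.
by move=> [hy ->]; rewrite adde0 /= diracE memNset.
Qed.

(** Mecke's equation is read from right to left: the integral over the new point [y] becomes a sum
    over the points of [nu] outside the hull, which [H_mass] evaluates. *)
Let A_step n k : (k < n)%N -> A n k.+1 = (n - k)%:R%:E * A n k.
Proof.
move=> kn; rewrite /A.
rewrite (integral_power_measureS hX0 lfin (@measurable_intH n k.+1)); last first.
  by move=> z; exact: integral_ge0.
have [m mE] := power_measure_sigma_finite hX0 lfin k; rewrite -mE.
rewrite -ge0_integralZl//; last 2 first.
- exact: measurable_intH.
- by move=> x _; exact: integral_ge0.
apply: eq_integral => x _.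
pose f (p : N * X) := (\1_[set p : N * X | ~ h (pm_add (tup x) p.1) p.2] p)%:E *
  @H n k (x, p.1).
have mhs : measurable [set p : N * X | ~ h (pm_add (tup x) p.1) p.2].
  have ms : measurable_fun [set: N * X] (fun p => (pm_add (tup x) p.1, p.2)).
    by apply: measurable_fun_pair => //; exact: measurable_pm_add.
  exact: (measurableC (measurableT_preimage ms (measurable_hull_pair hX hX0 hdel))).
have mHx : measurable_fun [set: N] (fun mu => @H n k (x, mu)).
  have mx : measurable_fun [set: N] (fun mu : N => (x, mu)) by exact: measurable_fun_pair.
  exact: (measurableT_comp (@measurable_H n k) mx).
have mf : measurable_fun [set: N * X] f.
  apply: emeasurable_funM; first exact/measurable_EFinP/measurable_indic.
  exact: (measurableT_comp mHx measurable_fst).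
transitivity (\int[lam]_y \int[Q]_mu f (pm_add mu (pm_dirac R X0 y), y)).
  apply: eq_integral => y _; apply: eq_integral => mu _; rewrite H_cons /f/=.
  by congr (_%:E * _); rewrite !indicE.
rewrite -(mecke hX0 lfin hQ)//; last by move=> p; rewrite mule_ge0// lee_fin.
rewrite -ge0_integralZl//.
apply: eq_integral => nu _; rewrite -H_mass; last exact: ltnW.
rewrite /f /= ge0_integralZr//; last first.
  apply/measurable_EFinP.
  have mI : measurable_fun [set: N * X]
      (\1_[set p : N * X | ~ h (pm_add (tup x) p.1) p.2] : N * X -> R).
    exact: measurable_indic.
  have my : measurable_fun [set: X] (fun y : X => (nu, y)) by exact: measurable_fun_pair.
  exact: (measurableT_comp mI my).
rewrite muleC; congr (_ * _).
have mh := measurable_hull hX hX0 hdel (pm_add (tup x) nu).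
rewrite (eq_integral (fun y => (\1_(~` h (pm_add (tup x) nu)) y)%:E)).
  by rewrite integral_indic ?setIT//; exact: measurableC.
by move=> y _; rewrite !indicE.
Qed.

Let A_ffact n k : (k <= n)%N -> A n k = (n ^_ k)%:R%:E * A n 0.
Proof.
elim: k => [_|k IH kn]; first by rewrite ffactn0 mul1e.
rewrite A_step// IH; last exact: ltnW.
by move: (A n 0) => a; rewrite ffactnSr mulnC natrM EFinM muleA.
Qed.

(** With all [n] points drawn, the tuple lies below a selection of the same finite mass and
    therefore equals it. [del_addP] then separates a condition on [x] alone from a void condition on
    [mu]. *)
Let H_full n (x : n.-tuple X) mu :
  @H n n (x, mu) = (\1_(C_ del n) x)%:E *
    ((\1_[set nu : N | nu (~` h (tup x)) = 0%E] mu)%:E *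
     F (tup x, pm_restr hX0 mu (h (tup x)))).
Proof.
rewrite /H /G /=; set nu := pm_add (tup x) mu.
have mh := measurable_hull hX hX0 hdel nu.
have key : (@V n (x, mu) /\ S n nu) <-> del nu ≡μ tup x.
  split=> [[v s]|e]; last first.
    split; last by rewrite /S /= e// pm_tupleT.
    by rewrite /V /= -e ?del_hull.
  have le : measure_le (tup x) (del nu).
    move=> B mB; rewrite (delE hX hX0 hdel)// (pm_DI (tup x) mB mh).
    rewrite [X in _ + X](_ : _ = 0) ?adde0.
      by rewrite pm_addE leeDl.
    apply/eqP; rewrite eq_le measure_ge0 andbT -[leRHS]v.
    by apply: le_measure; rewrite ?inE//; exact: measurableI.
  have [rho rhoE] := pm_difference hX0 le.
  have rho0 : rho setT = 0.
    have := rhoE _ measurableT; rewrite pm_addE s pm_tupleT.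
    by move=> /(congr1 (fun z => z - n%:R%:E)); rewrite addeAC subee// add0e.
  move=> B mB; rewrite -rhoE// pm_addE (_ : rho B = 0) ?adde0//.
  apply/eqP; rewrite eq_le measure_ge0 andbT -rho0.
  by apply: le_measure; rewrite ?inE.
have C : del nu ≡μ tup x <-> C_ del n x /\ mu (~` h (tup x)) = 0.
  exact: (del_addP hX hX0 hdel).
have [e|ne] := pselect (del nu ≡μ tup x).
  have [v s] := proj2 key e; have [c z] := proj1 C e.
  rewrite !indicE !mem_set// !mul1e; apply: measurable_pm_eq2 => // B mB.
  (* The total configuration has the hull of its selection, the tuple, and by [v] no tuple point
     lies in it. So only [mu] contributes to the restriction. *)
  have hE : h nu = h (tup x) by rewrite -(hull_del hX0 hdel) (hull_eq hdel e).
  have mh' := measurable_hull hX hX0 hdel (tup x).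
  rewrite !pm_restrE ?hE// pm_addE (_ : tup x (B `&` _) = 0) ?add0e//.
  apply/eqP; rewrite eq_le measure_ge0 andbT -v /= -/nu hE.
  by apply: le_measure; rewrite ?inE//; exact: measurableI.
have nk : ~ (@V n (x, mu) /\ S n nu) by move/key.
have nC : ~ (C_ del n x /\ mu (~` h (tup x)) = 0) by move/C.
rewrite !indicE muleA [RHS]muleA -!EFinM -!natrM !mulnb.
rewrite (_ : _ && _ = false); last first.
  by apply/negbTE/negP => /andP[]; rewrite !inE => v s; exact: nk.
rewrite (_ : _ && _ = false) ?mul0e//.
by apply/negbTE/negP => /andP[]; rewrite !inE => v s; exact: nC.
Qed.

Lemma stopping_formula n :
  \int[Q]_mu ((\1_[set mu | del mu setT = n%:R%:E] mu)%:E *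
              F (del mu, pm_restr hX0 mu (hull del mu))) =
  (n`!%:R^-1)%:E * \int[power_measure lam n]_(x in C_ del n)
    (expeR (- lam (~` hull del (tup x))) *
     \int[Q]_mu F (tup x, pm_restr hX0 mu (hull del (tup x)))).
Proof.
transitivity ((n`!%:R^-1)%:E * A n n).
  (* At k = n the falling factorial is n!, and [A n 0] is the left side. *)
  rewrite A_ffact// -[LHS]A0E ffactnn; move: (A n 0) => a.
  by rewrite muleA -EFinM mulVf ?mul1e// pnatr_eq0 -lt0n fact_gt0.
have [m mE] := power_measure_sigma_finite hX0 lfin n; rewrite /A -mE.
congr (_ * _); rewrite [RHS]integral_mkcond; apply: eq_integral => x _.
rewrite patchE; under eq_integral do rewrite H_full.
have mh := measurable_hull hX hX0 hdel (tup x).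
have [xC|xC] := boolP (x \in C_ del n); rewrite indicE.
  rewrite xC; under eq_integral do rewrite mul1e.
  apply: (pp_void_integral hX0 hQ mh (f := fun nu => F (tup x, nu))) => //.
  by apply: measurableT_comp => //; exact: measurable_fun_pair.
by rewrite (negbTE xC) integral0_eq// => mu _; rewrite mul0e.
Qed.

End stopping_formula.

(** * Summation over selection sizes and the conditional law *)

Section finite_selection.
Context (R : realType) (d : measure_display) (X : measurableType d).
Context (X0 : set (set X)) (hX0 : localising_ring X0).
Notation N := (point_measure R X0).
Context (del : N -> N) (hdel : generator del) (Q : probability N R).
Hypothesis fin : Q [set mu | del mu setT = +oo] = 0.

(** A finite total mass is an integer by [pm_natT], so the events of a given selection size exhaust
    N up to a null set. *)
Lemma integral_finite_selection (Psi : N -> \bar R) :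
  measurable_fun [set: N] Psi -> (forall mu, 0 <= Psi mu) ->
  \int[Q]_mu Psi mu = \sum_(n <oo)
    \int[Q]_mu ((\1_[set mu | del mu setT = n%:R%:E] mu)%:E * Psi mu).
Proof.
move=> mPsi Psi0.
pose S n : set N := [set mu | del mu setT = n%:R%:E].
have mS n : measurable (S n) := measurable_del_size hdel n.
have tS : trivIset [set: nat] S.
  by move=> i j _ _ [mu []]; rewrite /S/= => -> /EFin_natI.
have US : [set: N] `\` [set mu | del mu setT = +oo] = \bigcup_n S n.
  apply/seteqP; split => [mu [_ /= h]|mu [n _ /= h]].
    have [|k kE] := pm_natT hX0 (mu := del mu) measurableT.
      by rewrite ltey; exact/eqP.
    by exists k.
  by split => //; rewrite /= h.
have mdT := measurableT_comp (measurable_pm_ev measurableT) (gen_measurable hdel).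
rewrite (@ge0_negligible_integral _ _ _ _ _ [set mu | del mu setT = +oo])//; last first.
  exact: (measurableT_preimage mdT (emeasurable_set1 +oo)).
rewrite US ge0_integral_bigcup//; last exact: measurable_funTS.
apply: eq_eseriesr => n _; rewrite integral_mkcond; apply: eq_integral => mu _.
by rewrite patchE indicE; case: ifPn => _; rewrite ?mul1e ?mul0e.
Qed.

End finite_selection.

Section poisson_law.
Context (R : realType) (d : measure_display) (X : measurableType d).
Context (X0 : set (set X)) (hX0 : localising_ring X0).
Notation N := (point_measure R X0).

(** The restricted canonical process shows that a law as required exists, so the choice operator
    does not return its default; uniqueness in law then identifies its value. *)
Lemma poisson_law_restriction (Q : probability N R)
    (lam : {measure set X -> \bar R}) (D : set X) (A : set N) :
  locally_finite X0 lam -> poisson_process Q (@id N) lam ->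
  measurable D -> measurable A ->
  poisson_law X0 (restriction lam D) A = Q [set mu | A (pm_restr hX0 mu D)].
Proof.
move=> lfin hQ mD mA.
have hr := pp_restr hX0 hQ mD.
have hl : poisson_process (poisson_law X0 (restriction lam D)) (@id N) (restriction lam D).
  apply: (@xgetPex _ point
    [set Q' : probability N R | poisson_process Q' (@id N) (restriction lam D)]).
  by exists (law Q (pp_measurable hr)); exact: (pp_law hr).
apply: (pp_unique hX0 _ hl hr mA) => B XB.
by apply: lfin; apply: (lring_setI hX0).
Qed.

End poisson_law.

Theorem theorem3p2 (R : realType)
    (dX : measure_display) (X : measurableType dX) (hX : borel_space R X)
    (X0 : set (set X)) (hX0 : localising_ring X0)
    (del : point_measure R X0 -> point_measure R X0) (hdel : generator del)
    (dO : measure_display) (Omega : measurableType dO)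
    (P : probability Omega R)
    (lam : {measure set X -> \bar R}) (hlam : locally_finite X0 lam)
    (eta : Omega -> point_measure R X0) (heta : poisson_process P eta lam) :
  (forall n : nat, (0 < n)%N ->
    forall W : set (point_measure R X0 * point_measure R X0), measurable W ->
    \int[P]_w
      (\1_[set w' | del (eta w') [set: X] = n%:R%:E] w
       * \1_W (del (eta w), pm_restr hX0 (eta w) (hull del (eta w))))%:E
    = (n`!%:R^-1)%:E *
      \int[P]_w \int[power_measure lam n]_(x in C_ del n)
        ((\1_W (pm_tuple R X0 x,
                pm_restr hX0 (eta w) (hull del (pm_tuple R X0 x))))%:E
         * expeR (- lam (~` hull del (pm_tuple R X0 x)))))
  /\
  ({ae P, forall w, del (eta w) [set: X] < +oo} ->
    forall A : set (point_measure R X0), measurable A ->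
    cond_prob P (del \o eta)
      [set w | A (pm_restr hX0 (eta w) (hull del (eta w)))]
      (fun w => poisson_law X0 (restriction lam (hull del (eta w))) A)).
Proof.
pose N := point_measure R X0.
pose Q := law P (pp_measurable heta).
have hQ : poisson_process Q (@id N) lam := pp_law heta.
have mh mu : measurable (hull del mu) := measurable_hull hX hX0 hdel mu.
have mdel : measurable_fun [set: N] del := gen_measurable hdel.
have mrs : measurable_fun [set: N] (fun mu => pm_restr hX0 mu (hull del mu)).
  exact: (measurable_hull_restr hX hX0 hdel).
have mpr : measurable_fun [set: N] (fun mu => (del mu, pm_restr hX0 mu (hull del mu))).
  exact: measurable_fun_pair.
split.
  move=> n _ W mW.
  pose F (p : N * N) : \bar R := (\1_W p)%:E.
  have mF : measurable_fun [set: N * N] F by exact/measurable_EFinP/measurable_indic.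
  have F0 p : 0 <= F p by rewrite lee_fin.
  pose S : set N := [set mu | del mu setT = n%:R%:E].
  pose G mu := (\1_S mu)%:E * F (del mu, pm_restr hX0 mu (hull del mu)).
  have mG : measurable_fun [set: N] G.
    apply: emeasurable_funM; last exact: (measurableT_comp mF mpr).
    by apply/measurable_EFinP/measurable_indic; exact: measurable_del_size.
  transitivity (\int[Q]_mu G mu).
    rewrite [RHS](integral_law P (pp_measurable heta) mG)//.
    by move=> mu; rewrite mule_ge0// lee_fin.
  rewrite (stopping_formula hX hX0 hdel hlam hQ mF F0).
  congr (_ * _).
  have [m mE] := power_measure_sigma_finite hX0 hlam n; rewrite -mE.
  pose t (x : n.-tuple X) := pm_tuple R X0 x.
  have mt : measurable_fun [set: n.-tuple X] t := @measurable_pm_tuple R _ X X0 n.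
  (* The stopping formula has the expectation inside the integral over tuples, the claim has it
     outside. [K] is the jointly measurable integrand to which Tonelli's theorem applies. *)
  pose K (p : n.-tuple X * N) : \bar R := (\1_(C_ del n) p.1)%:E *
    (F (t p.1, pm_restr hX0 p.2 (hull del (t p.1))) *
     expeR (- lam (~` hull del (t p.1)))).
  have mt1 := measurableT_comp mt (@measurable_fst _ _ (n.-tuple X) N).
  have mrt := measurable_hull_restr hX hX0 hdel (@measurable_snd _ _ (n.-tuple X) N) mt1.
  have mK : measurable_fun [set: n.-tuple X * N] K.
    apply: emeasurable_funM.
      apply/measurable_EFinP.
      have mI : measurable_fun [set: n.-tuple X] (\1_(C_ del n) : n.-tuple X -> R).
        by apply: measurable_indic; exact: measurable_C_.
      exact: (measurableT_comp mI measurable_fst).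
    apply: emeasurable_funM; last exact: (measurable_exp_hullC hX hX0 hdel hQ mt1).
    by apply: (measurableT_comp mF); exact: measurable_fun_pair.
  have K0 p : 0 <= K p by rewrite mule_ge0 ?lee_fin// mule_ge0// expeR_ge0.
  transitivity (\int[m]_x \int[Q]_mu K (x, mu)).
    rewrite integral_mkcond; apply: eq_integral => x _; rewrite patchE /K /= indicE.
    case: ifPn => xC; last by rewrite integral0_eq// => mu _; rewrite mul0e.
    under [RHS]eq_integral do rewrite mul1e.
    rewrite ge0_integralZr ?expeR_ge0//; first by rewrite muleC.
    apply: (measurableT_comp mF); apply: measurable_fun_pair => //.
    exact: measurable_pm_restr.
  rewrite (fubini_tonelli (m1 := m) (m2 := Q) K mK K0).
  rewrite (integral_law P (pp_measurable heta)); first last.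
  - by move=> mu; exact: integral_ge0.
  - exact: (measurable_fun_fubini_tonelli_G (m1 := m) K mK K0).
  apply: eq_integral => w _; rewrite [RHS]integral_mkcond; apply: eq_integral => x _.
  by rewrite patchE /K /= indicE; case: ifPn => _; rewrite ?mul1e ?mul0e.
move=> hfin A mA.
have fin : Q [set mu | del mu setT = +oo] = 0.
  have mdT := measurableT_comp (measurable_pm_ev measurableT) mdel.
  have mI := measurableT_preimage mdT (emeasurable_set1 +oo).
  apply: (measure_negligible (mu := P)).
    exact: (measurableT_preimage (pp_measurable heta) mI).
  case: hfin => U [mU U0 sU]; exists U; split => // w /= h.
  by apply: sU; rewrite /= h ltxx.
pose g (phi : N) := Q [set mu | A (pm_restr hX0 mu (hull del phi))].
have mg : measurable_fun [set: N] g.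
  have mp := measurable_hull_restr hX hX0 hdel
    (@measurable_snd _ _ N N) (@measurable_fst _ _ N N).
  have := measurable_fun_xsection Q (measurableT_preimage mp mA).
  rewrite (_ : (_ \o _) = g)//; apply/funext => phi /=; congr (Q _).
  by apply/seteqP; split => mu; rewrite /xsection/= inE.
(* Replacing the hull of [eta w] by that of its selection exhibits the conditional law as a function
   of the selection, which gives the measurability required of a version. *)
have plE w : poisson_law X0 (restriction lam (hull del (eta w))) A = g (del (eta w)).
  by rewrite (poisson_law_restriction hX0 hlam hQ)// /g (hull_del hX0 hdel).
split.
  under eq_fun do rewrite plE.
  move=> _ Y mY; rewrite setTI; exists (g @^-1` Y); first exact: measurableT_preimage.
  by rewrite setTI.
move=> B mB; under eq_integral do rewrite plE.
pose F1 (p : N * N) : \bar R := (\1_B p.1)%:E * g p.1.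
pose F2 (p : N * N) : \bar R := (\1_B p.1)%:E * (\1_A p.2)%:E.
have mI C : measurable C -> measurable_fun [set: N] (fun mu => (\1_C mu)%:E : \bar R).
  by move=> mC; exact/measurable_EFinP/measurable_indic.
have mF1 : measurable_fun [set: N * N] F1.
  apply: emeasurable_funM; first exact: (measurableT_comp (mI _ mB) measurable_fst).
  exact: (measurableT_comp mg measurable_fst).
have mF2 : measurable_fun [set: N * N] F2.
  apply: emeasurable_funM; first exact: (measurableT_comp (mI _ mB) measurable_fst).
  exact: (measurableT_comp (mI _ mA) measurable_snd).
have F10 p : 0 <= F1 p by rewrite mule_ge0 ?lee_fin.
have F20 p : 0 <= F2 p by rewrite mule_ge0 ?lee_fin.
transitivity (\int[Q]_mu F1 (del mu, pm_restr hX0 mu (hull del mu))).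
  rewrite (integral_law P (pp_measurable heta) (measurableT_comp mF1 mpr))//=.
  rewrite integral_mkcond; apply: eq_integral => w _; rewrite patchE /F1 /= indicE.
  rewrite (_ : (w \in _) = (del (eta w) \in B)); last by apply/idP/idP; rewrite !inE.
  by case: ifPn => _; rewrite ?mul1e ?mul0e.
transitivity (\int[Q]_mu F2 (del mu, pm_restr hX0 mu (hull del mu))).
  rewrite (integral_finite_selection hX0 hdel fin (measurableT_comp mF1 mpr));
    last by move=> mu; exact: F10.
  rewrite (integral_finite_selection hX0 hdel fin (measurableT_comp mF2 mpr));
    last by move=> mu; exact: F20.
  apply: eq_eseriesr => n _ /=.
  rewrite (stopping_formula hX hX0 hdel hlam hQ mF1 F10).
  rewrite (stopping_formula hX hX0 hdel hlam hQ mF2 F20).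
  have [m mE] := power_measure_sigma_finite hX0 hlam n; rewrite -mE.
  congr (_ * _); apply: eq_integral => x _; congr (_ * _).
  (* Once the tuple is fixed, [F1] no longer depends on the configuration, and the value of [g] at
     the tuple is by definition the remaining integral of [F2]. *)
  rewrite /F1 /F2 /= integral_cst//= probability_setT mule1.
  have mrx := @measurable_pm_restr R _ X X0 hX0 _ (mh (pm_tuple R X0 x)).
  have mAx : measurable_fun [set: N]
      (fun mu => (\1_A (pm_restr hX0 mu (hull del (pm_tuple R X0 x))))%:E : \bar R).
    exact: (measurableT_comp (mI _ mA) mrx).
  rewrite (ge0_integralZl _ _ mAx) ?lee_fin//.
  congr (_ * _); rewrite /g.
  transitivity (\int[Q]_mu
    (\1_[set mu | A (pm_restr hX0 mu (hull del (pm_tuple R X0 x)))] mu)%:E).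
    by rewrite integral_indic ?setIT//; exact: (measurableT_preimage mrx mA).
  by apply: eq_integral => mu _; rewrite !indicE.
rewrite (integral_law P (pp_measurable heta) (measurableT_comp mF2 mpr))//=.
have mE : measurable ([set w | A (pm_restr hX0 (eta w) (hull del (eta w)))] `&`
                      (del \o eta) @^-1` B).
  apply: measurableI.
    exact: (measurableT_preimage (measurableT_comp mrs (pp_measurable heta)) mA).
  exact: (measurableT_preimage (measurableT_comp mdel (pp_measurable heta)) mB).
rewrite -[in RHS](setIT (_ `&` _)) -integral_indic//.
apply: eq_integral => w _; rewrite /F2 /= !indicE in_setI -EFinM -natrM mulnb andbC.
by congr ((_ && _)%:R%:E); apply/idP/idP; rewrite !inE.
Qed.
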